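(* Let $\Gamma$ be a (finite, simplicial) connected graph. Then $A_\Gamma$ has linear divergence if and only if $\Gamma$ is a join; otherwise its divergence is quadratic.
   Context: Right-angled Artin group: for a finite simplicial graph $\Gamma$ with vertex set $V$, $A_\Gamma=\langle V\mid vw=wv$ whenever $v,w$ are joined by an edge of $\Gamma\rangle$. A graph is a join if it is obtained from two non-empty graphs $\Gamma_1,\Gamma_2$ by connecting every vertex of $\Gamma_1$ to every vertex of $\Gamma_2$ by an edge. Divergence: let $X$ be a geodesic metric space and $\rho(k)=\delta k-\lambda$ with $0<\delta<1$, $\lambda\ge0$. For $a,b,c\in X$, set $k=d(c,\{a,b\})$ and let $div(a,b,c;\rho)$ be the length of the shortest path in $X$ from $a$ to $b$ which lies outside the ball of radius $\rho(k)$ about $c$ (and $\infty$ if no such path exists). The divergence of $X$ with respect to $\rho$ is $Div(X,\rho)(r)=\sup\{div(a,b,c;\rho)\mid a,b,c\in X,\ d(a,b)\le r\}$. The divergence of a finitely generated group $G$ is that of a Cayley graph of $G$ with respect to a finite generating set, with $\rho(r)=\tfrac12 r-2$. Linear means bounded above by a linear function of $r$; quadratic means bounded above and below, for large $r$, by quadratic functions of $r$ (with positive leading coefficients).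
   Formalization: The graph is assumed non-empty, and ''otherwise its divergence is quadratic'' is claimed only for graphs with at least two vertices: for a single vertex the group is Z, whose divergence is infinite for large r; the ''if and only if'' still covers the single vertex. *)

(* Defs.v *)
From HB Require Import structures.
From mathcomp Require Import all_boot all_order all_algebra.
From mathcomp Require Import generic_quotient ring.
From mathcomp Require Import all_classical all_reals all_analysis.

Set Implicit Arguments.
Unset Strict Implicit.
Unset Printing Implicit Defensive.

Import Order.TTheory GRing.Theory Num.Theory.
Import numFieldNormedType.Exports.

Local Open Scope classical_set_scope.
Local Open Scope ring_scope.

Section Divergence.
Context {R : realType} {X : metricType R}.
Implicit Types (a b c : X) (g : R -> X) (rho : R -> R) (r : R).

Definition is_curve a b g :=
  [/\ {within `[0, 1], continuous g}, g 0 = a & g 1 = b].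

Definition curve_length g : \bar R :=
  ereal_sup [set (\sum_(i < size s)
                    mdist (g (nth 0 (0 :: s) i)) (g (nth 0 s i)))%:E
            | s in [set s : seq R | itv_partition 0 1 s]].

Definition dist_to_pair c a b : R := Num.min (mdist c a) (mdist c b).

(* The ball that has to be avoided is the open one, and it is empty when its
   radius is nonpositive. The infimum of the empty set is +oo. *)
Definition div rho a b c : \bar R :=
  ereal_inf [set curve_length g
            | g in [set g | is_curve a b g /\
                forall t, t \in `[0, 1] ->
                  rho (dist_to_pair c a b) <= mdist c (g t)]].

Definition Div rho r : \bar R :=
  ereal_sup [set div rho p.1.1 p.1.2 p.2
            | p in [set p : X * X * X | mdist p.1.1 p.1.2 <= r]].

End Divergence.

Arguments Div {R} X rho r.

(* Div is nondecreasing in r, so an affine bound for large r gives one for all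
   r >= 0. *)
Definition linear_growth {R : realType} (f : R -> \bar R) : Prop :=
  exists a b : R, forall r, 0 <= r -> (f r <= (a * r + b)%:E)%E.

Definition quadratic_growth {R : realType} (f : R -> \bar R) : Prop :=
  exists a b c a' b' c' : R, [/\ 0 < a, 0 < a' &
    \forall r \near +oo,
      ((a * r ^+ 2 + b * r + c)%:E <= f r)%E /\
      (f r <= (a' * r ^+ 2 + b' * r + c')%:E)%E].

Record connected_graph := ConnectedGraph {
  vertex :> choiceType;
  adj : rel vertex;
  adj_sym : symmetric adj;
  adj_irr : irreflexive adj;
  adj_conn : forall x y, exists2 p, path adj x p & last x p = y
}.

Section Realization.
Context {R : realType} {G : connected_graph}.
Implicit Types (x y z : G) (s t : R).

(* Barycentric coordinates of the point at distance s from x on the edge from x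
   to y; the vertex x when x = y. *)
Definition edge_point x y s : G -> R :=
  fun z => (1 - s) * (z == x)%:R + s * (z == y)%:R.

Definition in_realization (f : G -> R) : Prop :=
  exists x y s, [/\ (x == y) || adj x y, s \in `[0, 1] & f = edge_point x y s].

End Realization.

Record realization (R : realType) (G : connected_graph) := Realization {
  coord :> G -> R;
  coordP : in_realization coord
}.

HB.instance Definition _ R G := gen_eqMixin (realization R G).
HB.instance Definition _ R G := gen_choiceMixin (realization R G).

Section RealizationMetric.
Context {R : realType} {G : connected_graph}.
Implicit Types (p q r : realization R G) (x y z : G) (s t l : R).

(* [pl_path p q l]: p and q are joined by a concatenation of finitely many
   subsegments of edges, of total length l. *)
Inductive pl_path : realization R G -> realization R G -> R -> Prop :=
| pl_nil p : pl_path p p 0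
| pl_cons x y s t p q r l :
    adj x y -> s \in `[0, 1] -> t \in `[0, 1] ->
    coord p = edge_point x y s -> coord q = edge_point x y t ->
    pl_path q r l -> pl_path p r (`|s - t| + l).

Definition path_dist p q : R := inf [set l | pl_path p q l].

Lemma coord_inj p q : coord p = coord q -> p = q.
Proof.
case: p q => [f fP] [g gP] /= fg; subst g; congr Realization.
exact: Prop_irrelevance.
Qed.

Lemma pl_path_ge0 p q l : pl_path p q l -> 0 <= l.
Proof. by elim=> // *; rewrite addr_ge0. Qed.

Lemma pl_path_cat p q r l m :
  pl_path p q l -> pl_path q r m -> pl_path p r (l + m).
Proof.
elim=> [p'|x y s t p' q' r' l' xy s01 t01 p'E q'E _ IH] qr; first by rewrite add0r.
by rewrite -addrA; apply: (pl_cons xy s01 t01 p'E q'E); exact: IH.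
Qed.

Lemma pl_path_sym p q l : pl_path p q l -> pl_path q p l.
Proof.
elim=> [p'|x y s t p' q' r' l' xy s01 t01 p'E q'E _ IH]; first exact: pl_nil.
rewrite addrC; apply: pl_path_cat IH _; rewrite distrC -[`|_|]addr0.
exact: (pl_cons xy t01 s01 q'E p'E (pl_nil p')).
Qed.

Lemma le_coord_pl_path p q l z : pl_path p q l -> `|p z - q z| <= l.
Proof.
elim=> [p'|x y s t p' q' r' l' xy s01 t01 p'E q'E _ IH].
  by rewrite subrr normr0.
rewrite (le_trans (ler_distD (q' z) _ _)) ?lerD//.
have -> : p' z - q' z = (s - t) * ((z == y)%:R - (z == x)%:R).
  by rewrite p'E q'E /edge_point; ring.
rewrite normrM ler_piMr//.
by case: (z == y); case: (z == x); rewrite ?subrr ?subr0 ?sub0r ?normrN ?normr1 ?normr0.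
Qed.

Lemma vertex_realization x : in_realization (edge_point x x 0 : G -> R).
Proof. by exists x, x, 0; rewrite eqxx bound_itvE. Qed.

Definition vpoint x : realization R G := Realization (vertex_realization x).

Lemma edge_point0 x y : edge_point x y 0 = edge_point x x 0 :> (G -> R).
Proof. by apply/funext => z; rewrite /edge_point !mul0r. Qed.

Lemma edge_point1 x y : edge_point x y 1 = edge_point y y 0 :> (G -> R).
Proof.
by apply/funext => z; rewrite /edge_point subrr subr0 !mul0r add0r addr0.
Qed.

Lemma edge_pointxx x s : edge_point x x s = edge_point x x 0 :> (G -> R).
Proof.
by apply/funext => z; rewrite /edge_point -!mulrDl subrK subr0 addr0.
Qed.

Lemma pl_path_vertex p : exists x l, pl_path p (vpoint x) l.
Proof.
have [x [y [s [/orP[/eqP<-|xy] s01 pE]]]] := coordP p; exists x.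
  have -> : vpoint x = p by apply: coord_inj; rewrite pE /= edge_pointxx.
  by exists 0; exact: pl_nil.
exists (`|s - 0| + 0); apply: (pl_cons xy s01 _ pE _ (pl_nil _)) => /=.
  by rewrite bound_itvE.
by rewrite -(edge_point0 x y).
Qed.

Lemma pl_path_vertices x y : exists l, pl_path (vpoint x) (vpoint y) l.
Proof.
have [w xw <-] := adj_conn x y.
elim: w x xw => [|z w IH] x /=; first by exists 0; exact: pl_nil.
move=> /andP[xz /IH[l zl]]; exists (`|0 - 1| + l).
apply: (pl_cons xz _ _ _ _ zl); rewrite ?bound_itvE//=.
  by rewrite (edge_point0 x z).
by rewrite (edge_point1 x z).
Qed.

Lemma pl_path_exists p q : [set l | pl_path p q l] !=set0.
Proof.
have [x [k px]] := pl_path_vertex p; have [y [m qy]] := pl_path_vertex q.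
have [l xy] := pl_path_vertices x y.
exists (k + (l + m)); apply: pl_path_cat px _.
by apply: pl_path_cat xy _; apply: pl_path_sym.
Qed.

Lemma pl_path_has_inf p q : has_inf [set l | pl_path p q l].
Proof.
by split; [exact: pl_path_exists | exists 0 => l; exact: pl_path_ge0].
Qed.

Lemma path_dist_le p q l : pl_path p q l -> path_dist p q <= l.
Proof. by move=> pq; apply: ge_inf => //; exact: (pl_path_has_inf p q).2. Qed.

Lemma path_dist_ge p q m :
  (forall l, pl_path p q l -> m <= l) -> m <= path_dist p q.
Proof. by move=> h; apply: lb_le_inf => //; exact: pl_path_exists. Qed.

Lemma path_dist_ge0 p q : 0 <= path_dist p q.
Proof. by apply: path_dist_ge => l; exact: pl_path_ge0. Qed.

Lemma path_distxx p : path_dist p p = 0.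
Proof.
by apply/le_anti; rewrite path_dist_ge0 andbT; apply: path_dist_le; exact: pl_nil.
Qed.

Lemma path_dist_positivity p q : path_dist p q = 0 -> p = q.
Proof.
move=> pq0; apply: coord_inj; apply/funext => z.
apply/eqP; rewrite -subr_eq0 -normr_le0 -pq0.
by apply: path_dist_ge => l; exact: le_coord_pl_path.
Qed.

Lemma path_dist_sym p q : path_dist p q = path_dist q p.
Proof.
by congr inf; apply/seteqP; split=> l; exact: pl_path_sym.
Qed.

Lemma path_dist_triangle q p r :
  path_dist p r <= path_dist p q + path_dist q r.
Proof.
rewrite -lerBlDr; apply: path_dist_ge => l pq.
rewrite lerBlDr -lerBlDl; apply: path_dist_ge => m qr.
by rewrite lerBlDl; apply: path_dist_le; exact: pl_path_cat pq qr.
Qed.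

End RealizationMetric.

HB.instance Definition _ (R : realType) (G : connected_graph) :=
  isMetric.Build R (realization R G) path_distxx path_dist_positivity
    path_dist_sym path_dist_triangle.

Section Cayley.
Local Open Scope group_scope.
Context {G : groupType}.
Implicit Types (S : seq G) (g h : G).

Definition generates S : Prop :=
  forall g, exists2 w : seq G,
    all (fun x => (x \in S) || (x^-1 \in S)) w & g = \prod_(x <- w) x.

Definition cayley_adj S : rel G :=
  fun g h => (g != h) && ((g^-1 * h \in S) || (h^-1 * g \in S)).

Lemma cayley_adj_sym S : symmetric (cayley_adj S).
Proof. by move=> g h; rewrite /cayley_adj eq_sym orbC. Qed.

Lemma cayley_adj_irr S : irreflexive (cayley_adj S).
Proof. by move=> g; rewrite /cayley_adj eqxx. Qed.

Lemma cayley_adj_conn S : generates S ->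
  forall g h, exists2 p, path (cayley_adj S) g p & last g p = h.
Proof.
move=> genS g h; have [w wS hE] := genS (g^-1 * h).
have {hE}-> : h = g * \prod_(x <- w) x by rewrite -hE mulVKg.
elim: w g wS => [|x w IH] g /=; first by exists [::]; rewrite // big_nil mulg1.
case/andP=> xS wS; rewrite big_cons mulgA.
have [p pP pE] := IH (g * x) wS.
have [x1|x1] := eqVneq x 1.
  by move: pP pE; rewrite x1 mulg1; exists p.
exists (g * x :: p) => //=; rewrite pP andbT /cayley_adj mulKg invgM mulgVK xS andbT.
by apply: contraNneq x1 => gx; apply/eqP/(mulgI g); rewrite mulg1 -gx.
Qed.

Definition cayley_graph S (genS : generates S) : connected_graph :=
  ConnectedGraph (cayley_adj_sym S) (cayley_adj_irr S) (cayley_adj_conn genS).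

End Cayley.

Definition group_divergence (R : realType) (G : groupType) (S : seq G)
    (genS : generates S) : R -> \bar R :=
  Div (realization R (cayley_graph genS)) (fun k => 1 / 2 * k - 2).

Arguments group_divergence R {G S} genS.

Section Raag.
Context {V : finType}.
Variable E : rel V.

Notation word := (seq (V * bool)).
Implicit Types u v w : word.

(* The letter (x, b) is x when b = true and its inverse when b = false. *)
Inductive raag_eq : word -> word -> Prop :=
| raag_eq_refl w : raag_eq w w
| raag_eq_sym u v : raag_eq u v -> raag_eq v u
| raag_eq_trans v u w : raag_eq u v -> raag_eq v w -> raag_eq u w
| raag_eq_cat u u' v v' :
    raag_eq u u' -> raag_eq v v' -> raag_eq (u ++ v) (u' ++ v')
| raag_eq_cancel x b : raag_eq [:: (x, b); (x, ~~ b)] [::]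
| raag_eq_comm x y : E x y ->
    raag_eq [:: (x, true); (y, true)] [:: (y, true); (x, true)].

Definition raag_eqb : rel word := fun u v => `[< raag_eq u v >].

Lemma raag_eqb_refl : reflexive raag_eqb.
Proof. by move=> w; apply/asboolP; exact: raag_eq_refl. Qed.

Lemma raag_eqb_sym : symmetric raag_eqb.
Proof. by move=> u v; apply/asboolP/asboolP; exact: raag_eq_sym. Qed.

Lemma raag_eqb_trans : transitive raag_eqb.
Proof.
by move=> v u w /asboolP uv /asboolP vw; apply/asboolP; exact: raag_eq_trans vw.
Qed.

Canonical raag_equiv_rel :=
  EquivRel raag_eqb raag_eqb_refl raag_eqb_sym raag_eqb_trans.

Definition raag := {eq_quot raag_equiv_rel}%qT.

HB.instance Definition _ := Choice.on raag.
HB.instance Definition _ := EqQuotient.on raag.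

Definition word_inv w : word := rev [seq (x.1, ~~ x.2) | x <- w].

Definition raag_one : raag := (\pi_raag [::])%qT.
Definition raag_mul (g h : raag) : raag := (\pi_raag (repr g ++ repr h))%qT.
Definition raag_inv (g : raag) : raag := (\pi_raag (word_inv (repr g)))%qT.

Lemma raag_piP u v : (\pi_raag u = \pi_raag v)%qT <-> raag_eq u v.
Proof. by split=> [/eqmodP/asboolP//|uv]; apply/eqmodP/asboolP. Qed.

Lemma raag_eq_repr w : raag_eq (repr (\pi_raag w)%qT) w.
Proof. by apply/raag_piP; rewrite reprK. Qed.

Lemma word_inv_cat u v : word_inv (u ++ v) = word_inv v ++ word_inv u.
Proof. by rewrite /word_inv map_cat rev_cat. Qed.

Lemma raag_eq_catV w : raag_eq (w ++ word_inv w) [::].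
Proof.
elim: w => [|[x b] w IH]; first exact: raag_eq_refl.
rewrite -cat1s word_inv_cat -catA.
apply: raag_eq_trans (raag_eq_cancel x b).
rewrite [word_inv [:: _]]/= (catA w) -[X in raag_eq _ X]cat1s.
apply: raag_eq_cat; first exact: raag_eq_refl.
rewrite -[X in raag_eq _ X]cat0s.
by apply: raag_eq_cat IH _; exact: raag_eq_refl.
Qed.

Lemma word_invK : involutive word_inv.
Proof.
move=> w; rewrite /word_inv map_rev revK -map_comp -[RHS]map_id.
by apply: eq_map => -[x b] /=; rewrite negbK.
Qed.

Lemma raag_eq_Vcat w : raag_eq (word_inv w ++ w) [::].
Proof. by have := raag_eq_catV (word_inv w); rewrite word_invK. Qed.

Lemma raag_mulA : associative raag_mul.
Proof.
move=> g h k; apply/raag_piP.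
apply: (raag_eq_trans (v := repr g ++ repr h ++ repr k)).
  by apply: raag_eq_cat; [exact: raag_eq_refl|exact: raag_eq_repr].
rewrite catA; apply: raag_eq_cat; last exact: raag_eq_refl.
by apply: raag_eq_sym; exact: raag_eq_repr.
Qed.

Lemma raag_mul1 : left_id raag_one raag_mul.
Proof.
move=> g; rewrite -[RHS]reprK; apply/raag_piP; rewrite -[X in raag_eq _ X]cat0s.
by apply: raag_eq_cat; [exact: raag_eq_repr|exact: raag_eq_refl].
Qed.

Lemma raag_mulr1 : right_id raag_one raag_mul.
Proof.
move=> g; rewrite -[RHS]reprK; apply/raag_piP; rewrite -[X in raag_eq _ X]cats0.
by apply: raag_eq_cat; [exact: raag_eq_refl|exact: raag_eq_repr].
Qed.

Lemma raag_mulV : left_inverse raag_one raag_inv raag_mul.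
Proof.
move=> g; apply/raag_piP; apply: raag_eq_trans (raag_eq_Vcat (repr g)).
by apply: raag_eq_cat; [exact: raag_eq_repr|exact: raag_eq_refl].
Qed.

Lemma raag_mulrV : right_inverse raag_one raag_inv raag_mul.
Proof.
move=> g; apply/raag_piP; apply: raag_eq_trans (raag_eq_catV (repr g)).
by apply: raag_eq_cat; [exact: raag_eq_refl|exact: raag_eq_repr].
Qed.

HB.instance Definition _ := isGroup.Build raag
  raag_mulA raag_mul1 raag_mulr1 raag_mulV raag_mulrV.

Definition is_join : Prop :=
  exists A : {set V}, [/\ A != finset.set0, ~: A != finset.set0 &
    forall x y, x \in A -> y \notin A -> E x y].

Definition is_connected : Prop :=
  (0 < #|V|)%N /\ forall x y : V, connect E x y.

End Raag.

(* Main.v *)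
Require Import Defs.
From mathcomp Require Import all_boot all_order all_algebra.
From mathcomp Require Import generic_quotient zify ring lra.
From mathcomp Require Import all_classical all_reals all_analysis.

(** Why the theorem is true.

    All word metrics on the group are bi-Lipschitz equivalent, so one may argue
    with the generators of the graph as soon as constant factors in distances do
    not matter. The radius [k / 2 - 2] of the ball to be avoided does matter for
    the upper bounds, and it is dealt with first: of the two halves of a long
    geodesic with midpoint [a], one stays outside the ball of radius half the
    distance of [a] to the centre ([escape]). Moving along it, one gets as far
    from the centre as one likes in time linear in [k], and from then on crude
    estimates suffice; this is [joined_outside_half_ball], which reduces both
    upper bounds to estimates in word length ([detours]).

    For a join the group is a direct product of two infinite groups, and two
    far-away points are joined by changing one coordinate at a time, at linear
    cost ([join_detours]). For a connected graph with at least two vertices,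
    write an element far from 1 as a word of length at most [n], go far out in
    the direction of a generator, and peel off the letters of the word one after
    the other: a letter commutes with the large powers of a neighbouring
    generator, and from one generator to another one turns through flats spanned
    by adjacent generators. Each letter costs a linear amount, so the total is
    quadratic ([connected_detours]).

    For the lower bound let the graph be no join. Then its complement is
    connected and has a closed walk through all the vertices; the product of the
    letters of this walk, repeated forever, gives a line in the group. A
    hyperplane is a label [x] together with a coset of the subgroup generated by
    the vertices adjacent to [x]; the signed number of times that a path crosses
    it depends on the end points only ([crossing_eq]). Hence a path between two
    points of the line crosses all the hyperplanes in between. Consecutive
    letters of the line are not adjacent, so two hyperplanes of the line that are
    a full turn of the walk apart are strongly separated: no hyperplane meets
    both ([strongly_separated]). The distance between points of their carriers is
    therefore almost the distance of the first one to the line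
    ([wlen_le_crossing_path]). A path that avoids a ball of radius proportional
    to [n] about a point of the line thus crosses about [n] hyperplanes of the
    line that are a full turn apart from each other, at points at distance about
    [n] from the line, and it needs a length of about [n] between one of them and
    the next ([detour_length]).

    The passage between curves in the realization of the Cayley graph and paths
    in the graph is [lip_joined_path] in one direction and [curve_to_path] in the
    other. The lower bound holds for the graph with one vertex too; its values
    exceed every linear function, so linear divergence forces a join. *)

Set Implicit Arguments.
Unset Strict Implicit.
Unset Printing Implicit Defensive.

Import Order.TTheory GRing.Theory Num.Theory.
Import numFieldNormedType.Exports.

(** * Words and word length *)

Section RaagWords.
Local Open Scope group_scope.
Context {V : finType} {E : rel V}.
Implicit Types (u v w : seq (V * bool)) (a : V * bool) (g h : raag E) (T : pred V).

Definition elt u : raag E := (\pi_(raag E) u)%qT.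

Definition opp_letter a : V * bool := (a.1, ~~ a.2).

Lemma elt_eq u v : raag_eq E u v -> elt u = elt v.
Proof. by move=> uv; apply/raag_piP. Qed.

Lemma elt_cat u v : elt (u ++ v) = elt u * elt v.
Proof.
apply/elt_eq/raag_eq_sym; apply: raag_eq_cat; exact: raag_eq_repr.
Qed.

Lemma elt_nil : elt [::] = 1. Proof. by []. Qed.

Lemma elt_cons a u : elt (a :: u) = elt [:: a] * elt u.
Proof. by rewrite -elt_cat. Qed.

Lemma elt_rcons u a : elt (rcons u a) = elt u * elt [:: a].
Proof. by rewrite -cats1 elt_cat. Qed.

Lemma elt_surj g : exists u, elt u = g.
Proof. by exists (repr g); rewrite /elt reprK. Qed.

Lemma elt_inv u : elt (word_inv u) = (elt u)^-1.
Proof.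
by apply: (mulIg (elt u)); rewrite mulVg -elt_cat; apply/elt_eq/raag_eq_Vcat.
Qed.

Lemma elt_opp a : elt [:: opp_letter a] = (elt [:: a])^-1.
Proof. by rewrite -elt_inv. Qed.

Lemma raag_eq_swap x b y c :
  E x y -> raag_eq E [:: (x, b); (y, c)] [:: (y, c); (x, b)].
Proof.
move=> xy; apply/raag_piP; rewrite -![(\pi__ _)%qT]/(elt _).
rewrite elt_cons [RHS]elt_cons.
have xyC : commute (elt [:: (x, true)]) (elt [:: (y, true)]).
  by rewrite /commute -!elt_cat; apply/elt_eq/raag_eq_comm.
have XE d z : elt [:: (z, d)] =
    if d then elt [:: (z, true)] else (elt [:: (z, true)])^-1.
  by case: d => //; rewrite -elt_opp.
rewrite (XE b x) (XE c y) -/(commute _ _); case: b; case: c => //.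
- exact: commuteV.
- by apply/commute_sym/commuteV/commute_sym.
- by apply/commuteV/commute_sym/commuteV/commute_sym.
Qed.

(** A relation either survives the deletion of the letters outside [T] or becomes
    trivial. So there is a retraction onto the subgroup generated by [T]. *)
Lemma raag_eq_filter T u v : raag_eq E u v ->
  raag_eq E [seq a <- u | T a.1] [seq a <- v | T a.1].
Proof.
elim=> {u v} [w|u v _|v u w _ uv _ vw|u u' v v' _ uu' _ vv'|x b|x y xy].
- exact: raag_eq_refl.
- exact: raag_eq_sym.
- exact: raag_eq_trans uv vw.
- by rewrite !filter_cat; apply: raag_eq_cat.
- by rewrite /=; case: (T x); [exact: raag_eq_cancel|exact: raag_eq_refl].
- rewrite /=; case: (T x); case: (T y); try exact: raag_eq_refl.
  exact: raag_eq_comm.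
Qed.

Definition retract T g : raag E := elt [seq a <- repr g | T a.1].

Lemma retract_elt T u : retract T (elt u) = elt [seq a <- u | T a.1].
Proof. by apply/elt_eq/raag_eq_filter/raag_eq_repr. Qed.

Definition parabolic T g := exists2 u, all (T \o fst) u & elt u = g.

Lemma parabolic1 T : parabolic T 1. Proof. by exists [::]. Qed.

Lemma parabolicM T g h : parabolic T g -> parabolic T h -> parabolic T (g * h).
Proof.
move=> [u uT <-] [v vT <-]; exists (u ++ v); last exact: elt_cat.
by rewrite all_cat uT.
Qed.

Lemma parabolicV T g : parabolic T g -> parabolic T g^-1.
Proof.
move=> [u uT <-]; exists (word_inv u); last exact: elt_inv.
rewrite all_rev all_map; apply: sub_all uT; by move=> [x b].
Qed.

Lemma parabolic_letter T a : T a.1 -> parabolic T (elt [:: a]).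
Proof. by move=> Ta; exists [:: a]; rewrite //= Ta. Qed.

Lemma parabolic_retract T g : parabolic T g -> retract T g = g.
Proof. by move=> [u uT <-]; rewrite retract_elt (all_filterP uT). Qed.

Lemma ex_word_size g : exists n, `[< exists2 u, elt u = g & size u = n >].
Proof. by have [u gE] := elt_surj g; exists (size u); apply/asboolP; exists u. Qed.

Definition wlen g : nat := ex_minn (ex_word_size g).

Lemma wlen_elt u : wlen (elt u) <= size u.
Proof. by rewrite /wlen; case: ex_minnP => m _; apply; apply/asboolP; exists u. Qed.

Lemma wlen_word g : exists2 u, elt u = g & size u = wlen g.
Proof. by rewrite /wlen; case: ex_minnP => m /asboolP[u]; exists u. Qed.

Lemma wlen1 : wlen 1 = 0.
Proof. by apply/eqP; rewrite -leqn0; exact: (wlen_elt [::]). Qed.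

Lemma wlenM g h : wlen (g * h) <= wlen g + wlen h.
Proof.
have [u <- <-] := wlen_word g; have [v <- <-] := wlen_word h.
by rewrite -elt_cat -size_cat wlen_elt.
Qed.

Lemma wlenV g : wlen g^-1 = wlen g.
Proof.
suff H k : wlen k^-1 <= wlen k by apply/eqP; rewrite eqn_leq H -{1}[g]invgK H.
have [u <- <-] := wlen_word k; rewrite -elt_inv (leq_trans (wlen_elt _))//.
by rewrite size_rev size_map.
Qed.

Lemma wlen_le_mulr g h : wlen g <= wlen (g * h) + wlen h.
Proof. by rewrite -{1}[g](mulgK h) (leq_trans (wlenM _ _))// wlenV. Qed.

Lemma wlen_le_mull g h : wlen h <= wlen (g * h) + wlen g.
Proof. by rewrite -{1}[h](mulKg g) (leq_trans (wlenM _ _))// wlenV addnC. Qed.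

Lemma wlen_retract T g : wlen (retract T g) <= wlen g.
Proof.
have [u <- <-] := wlen_word g; rewrite retract_elt (leq_trans (wlen_elt _))//.
by rewrite size_filter count_size.
Qed.

(** The retraction does not lengthen words: it pushes a shortest word into the
    subgroup. *)
Lemma parabolic_word T g : parabolic T g ->
  exists u, [/\ all (T \o fst) u, elt u = g & size u = wlen g].
Proof.
move=> gT; have [u gE us] := wlen_word g.
exists [seq a <- u | T a.1].
have wE : elt [seq a <- u | T a.1] = g by rewrite -retract_elt gE parabolic_retract.
split=> //; first exact: filter_all.
apply/eqP; rewrite eqn_leq -{1}us size_filter count_size/=.
by rewrite -size_filter -{1}wE wlen_elt.
Qed.

(** An exponent sum, that is, a homomorphism to the integers; it bounds from below
    the length of powers and of positive words. *)
Definition expo T u : int :=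
  (\sum_(a <- u | T a.1) (if a.2 then 1 else -1))%R.

Lemma expo_eq T u v : raag_eq E u v -> expo T u = expo T v.
Proof.
rewrite /expo; elim=> {u v} // [u v w _ -> _ ->|u u' v v' _ IH1 _ IH2|x b|x y xy] //.
- by rewrite !big_cat/= IH1 IH2.
- by rewrite !big_cons big_nil/=; case: (T x) => //; case: b.
- by rewrite !big_cons big_nil/=; case: (T x); case: (T y).
Qed.

Lemma expo_cat T u v : (expo T (u ++ v) = expo T u + expo T v)%R.
Proof. by rewrite /expo big_cat. Qed.

Lemma expo_size T u : (`|expo T u| <= (size u)%:Z)%R.
Proof.
elim: u => [|a u IH]; first by rewrite /expo big_nil.
by rewrite /expo big_cons -/(expo T u) /=; case: (T a.1); case: a.2; lia.
Qed.

Lemma expo_wlen T u : (`|expo T u| <= (wlen (elt u))%:Z)%R.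
Proof.
have [v vE <-] := wlen_word (elt u).
by rewrite -(expo_eq T (iffLR (raag_piP E v u) vE)) expo_size.
Qed.

Lemma expo_nseq T n a :
  (expo T (nseq n a) = if T a.1 then (if a.2 then n%:Z else - n%:Z) else 0)%R.
Proof.
elim: n => [|n IH]; first by rewrite /expo big_nil; case: (T a.1); case: a.2.
rewrite /expo big_cons -/(expo T _) IH; case: (T a.1) => //.
by case: a.2; lia.
Qed.

End RaagWords.

(** * Hyperplanes crossed by words *)

Section Hyperplanes.
Local Open Scope group_scope.
Context {V : finType} {E : rel V}.
Hypotheses (symE : symmetric E) (irrE : irreflexive E).
Implicit Types (u v w : seq (V * bool)) (a : V * bool) (g h : raag E).
Implicit Types (H : raag E * V).

(** The hyperplane dual to the edge from [h] to [h * x] is encoded by the pair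
    (h, x). Moving the edge across commutation squares multiplies [h] by
    generators adjacent to [x], so a hyperplane amounts to a label [x] and a
    coset of the subgroup generated by the link of [x]. *)
Definition same_hyp H H' : bool :=
  (H.2 == H'.2) && `[< parabolic (E H.2) (H.1^-1 * H'.1) >].

(** An edge traversed backwards is based at its end point. *)
Definition step_hyp g a : raag E * V :=
  (if a.2 then g else g * elt [:: a], a.1).

Definition step_sign a : int := (if a.2 then 1 else -1)%R.

Fixpoint crossing H g u : int :=
  if u is a :: u' then
    ((if same_hyp H (step_hyp g a) then step_sign a else 0)
       + crossing H (g * elt [:: a])%g u')%R
  else 0%R.

Fixpoint path_hyps g u : seq (raag E * V) :=
  if u is a :: u' then step_hyp g a :: path_hyps (g * elt [:: a]) u' else [::].

Lemma same_hypP H H' : reflect (H.2 = H'.2 /\ parabolic (E H.2) (H.1^-1 * H'.1))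
  (same_hyp H H').
Proof. by apply: (iffP andP) => -[/eqP ? /asboolP]. Qed.

Lemma same_hyp_refl H : same_hyp H H.
Proof. by apply/same_hypP; rewrite mulVg; split=> //; exact: parabolic1. Qed.

Lemma same_hyp_sym H H' : same_hyp H H' = same_hyp H' H.
Proof.
suff I K K' : same_hyp K K' -> same_hyp K' K by apply/idP/idP; exact: I.
move=> /same_hypP[KK /parabolicV]; rewrite invgM invgK KK => K'K.
exact/same_hypP.
Qed.

Lemma same_hyp_trans H' H H'' :
  same_hyp H H' -> same_hyp H' H'' -> same_hyp H H''.
Proof.
move=> /same_hypP[e1 p1] /same_hypP[e2 p2]; apply/same_hypP.
split; first by rewrite e1.
by have := parabolicM p1; rewrite e1 => /(_ _ p2); rewrite mulgA mulgK.
Qed.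

Lemma same_hypr H H' H'' : same_hyp H' H'' -> same_hyp H H' = same_hyp H H''.
Proof.
move=> HH; apply/idP/idP => ?; first exact: same_hyp_trans HH.
by apply: same_hyp_trans (_ : same_hyp H'' H'); rewrite // same_hyp_sym.
Qed.

Lemma crossing_cat H g u v :
  (crossing H g (u ++ v) = crossing H g u + crossing H (g * elt u)%g v)%R.
Proof.
elim: u g => [|a u IH] g /=; first by rewrite add0r elt_nil mulg1.
by rewrite IH addrA [elt (a :: u)]elt_cons mulgA.
Qed.

(** Opposite sides of a commutation square lie in the same hyperplane, so the
    signed number of crossings is a cocycle: it depends on the end points only. *)
Lemma crossing_eq H u v : raag_eq E u v ->
  forall g, crossing H g u = crossing H g v.
Proof.
elim=> {u v} [w g|u v _ IH g|v u w _ IH1 _ IH2 g|u u' v v' uu' IH1 _ IH2 g|x b g|x y xy g].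
- by [].
- by rewrite IH.
- by rewrite IH1.
- by rewrite !crossing_cat IH1 IH2 (elt_eq uu').
- have /= -> : step_hyp (g * elt [:: (x, b)]) (x, ~~ b) = step_hyp g (x, b).
    rewrite /step_hyp; case: b => //=.
    by rewrite -mulgA -elt_cat (elt_eq (raag_eq_cancel E x true)) elt_nil mulg1.
  by rewrite addr0 /step_sign; case: ifP => //; case: b.
- have sq x' y' : E x' y' ->
      same_hyp (g, x') (g * elt [:: (y', true)], x').
    move=> xy'; apply/same_hypP; split=> //=; rewrite mulKg.
    exact: (parabolic_letter (a := (y', true))).
  have yx : E y x by rewrite symE.
  rewrite /= /step_hyp/= !addr0 -(same_hypr _ (sq _ _ xy)) -(same_hypr _ (sq _ _ yx)).
  by rewrite addrC.
Qed.

Lemma crossing_elt H g u v : elt u = elt v :> raag E ->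
  crossing H g u = crossing H g v.
Proof. by move=> /raag_piP uv; exact: crossing_eq. Qed.

Lemma crossing_split H g u : crossing H g u != 0%R ->
  exists u1 a u2, u = u1 ++ a :: u2 /\ same_hyp H (step_hyp (g * elt u1) a).
Proof.
elim: u g => [|a u IH] g //=.
case: ifP => [Ha _|_]; first by exists [::], a, u; rewrite elt_nil mulg1.
rewrite add0r => /IH[u1 [b [u2 [-> Hb]]]].
by exists (a :: u1), b, u2; rewrite elt_cons mulgA.
Qed.

(** One of the two ends of a crossing step lies in the coset of the hyperplane. *)
Lemma crossing_carrier H g u : crossing H g u != 0%R ->
  exists u1 u2, u = u1 ++ u2 /\ parabolic (E H.2) (H.1^-1 * (g * elt u1)).
Proof.
move=> /crossing_split[u1 [[x b] [u2 [->]]]].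
move=> /same_hypP[/= xE]; rewrite -{x}xE; case: b => Hb.
  by exists u1, ((H.2, true) :: u2); split.
by exists (rcons u1 (H.2, false)), u2; rewrite cat_rcons elt_rcons (mulgA g); split.
Qed.

Lemma crossing_letters T H g u :
  all (T \o fst) u -> ~~ T H.2 -> crossing H g u = 0%R.
Proof.
move=> uT HT; apply/eqP/negPn/negP => /crossing_split[u1 [a [u2 [uE]]]].
move=> /same_hypP[/= Ha _]; move: uT.
by rewrite uE all_cat /= -Ha (negbTE HT) andbF.
Qed.

Lemma commute_link x c g : parabolic (E x) g -> commute (elt [:: (x, c)]) g.
Proof.
move=> [u + <-]; elim: u => [_|[y d] u IH]; first exact: commute1.
rewrite [elt (_ :: u)]elt_cons /= => /andP[xy /IH uC]; apply: commuteM uC.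
by rewrite /commute -!elt_cat; exact/elt_eq/raag_eq_swap.
Qed.

Definition geodesic u : Prop := wlen (elt u : raag E) = size u.

Lemma geodesic_catl u v : geodesic (u ++ v) -> geodesic u.
Proof.
rewrite /geodesic size_cat elt_cat => uv.
apply/eqP; rewrite eqn_leq wlen_elt /= -(leq_add2r (size v)) -uv.
by rewrite (leq_trans (wlenM _ _))// leq_add2l wlen_elt.
Qed.

Lemma geodesic_catr u v : geodesic (u ++ v) -> geodesic v.
Proof.
rewrite /geodesic size_cat elt_cat => uv.
apply/eqP; rewrite eqn_leq wlen_elt /= -(leq_add2l (size u)) -uv.
by rewrite (leq_trans (wlenM _ _))// leq_add2r wlen_elt.
Qed.

(** Otherwise deleting the letters outside the link, the first of which is the
    letter itself, would give a shorter word. *)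
Lemma geodesic_leaves_link a u : geodesic (a :: u) ->
  ~ parabolic (E a.1) (elt (a :: u) : raag E).
Proof.
move=> au /parabolic_retract; rewrite retract_elt /= irrE => eE.
have := wlen_elt (E := E) [seq b <- u | E a.1 b.1].
by rewrite eE au size_filter leqNgt ltnS count_size.
Qed.

(** If a later step crossed the hyperplane of the first one, the word from the
    first letter up to this step would represent an element of the subgroup
    generated by the link of that letter, against [geodesic_leaves_link]. *)
Lemma geodesic_hyps g u : geodesic u ->
  pairwise (fun H H' => ~~ same_hyp H H') (path_hyps g u).
Proof.
elim: u g => //= a u IH g au; apply/andP; split; last first.
  by apply: IH; apply: (@geodesic_catr [:: a]).
have {IH} mem k H : H \in path_hyps k u ->
    exists u1 b u2, u = u1 ++ b :: u2 /\ H = step_hyp (k * elt u1) b.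
  elim: u {au IH} k => //= b u IH k; rewrite inE => /orP[/eqP->|].
    by exists [::], b, u; rewrite elt_nil mulg1.
  move=> /IH[u1 [c [u2 [-> ->]]]]; exists (b :: u1), c, u2.
  by rewrite [elt (b :: u1)]elt_cons mulgA.
apply/allP => H /mem[u1 [[x c] [u2 [uE ->]]]]; apply/negP => /same_hypP[/=].
case: a au => y b au /= yx; rewrite -{x}yx in uE *.
have au1 : geodesic ((y, b) :: u1).
  by apply: (@geodesic_catl _ ((y, c) :: u2)); rewrite /= -uE.
have au2 : geodesic ((y, b) :: rcons u1 (y, c)).
  by apply: (@geodesic_catl _ u2); rewrite /= cat_rcons -uE.
case: b au1 au2 {au} => au1 au2.
  case: c {uE} au2 => au2; rewrite -!mulgA mulKg => par.
    by apply: (geodesic_leaves_link au1); rewrite /= elt_cons.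
  by apply: (geodesic_leaves_link au2); rewrite /= elt_cons elt_rcons.
(* The first letter is negative here, so conjugation by it comes in; it commutes
   with its link. *)
have conj (k : raag E) : parabolic (E y) k ->
    elt [:: (y, false)] * k * elt [:: (y, true)] = k.
  move=> kP; have := commute_link false kP; rewrite /commute => ->.
  by rewrite -mulgA -elt_cat (elt_eq (raag_eq_cancel E y false)) elt_nil mulg1.
case: c {uE} au2 => au2; rewrite -!mulgA !invgM -!mulgA mulKg mulKg => par.
  apply: (geodesic_leaves_link au2); rewrite /= elt_cons elt_rcons mulgA.
  by rewrite conj.
apply: (geodesic_leaves_link au1); rewrite /= elt_cons.
rewrite -[_ * _]mulg1 -elt_nil -(elt_eq (raag_eq_cancel E y false)).
rewrite (elt_cat [:: (y, false)] [:: (y, true)]) -[X in parabolic _ X]mulgA.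
by rewrite (mulgA (elt u1)) (mulgA _ (elt u1 * _)) conj.
Qed.

Lemma crossing0 H g u :
  all (fun H' => ~~ same_hyp H H') (path_hyps g u) -> crossing H g u = 0%R.
Proof.
by elim: u g => //= a u IH g /andP[/negbTE-> /IH->]; rewrite addr0.
Qed.

Lemma crossing_hyps H g u :
  pairwise (fun H H' => ~~ same_hyp H H') (path_hyps g u) ->
  H \in path_hyps g u -> `|crossing H g u|%N = 1%N.
Proof.
elim: u g => //= a u IH g /andP[aH /IH{}IH]; rewrite inE => /orP[/eqP->|HH].
  rewrite same_hyp_refl crossing0// addr0 /step_sign.
  by case: a {aH IH} => x [].
have /allP/(_ _ HH) := aH; rewrite same_hyp_sym => /negbTE->.
by rewrite add0r IH.
Qed.

(** A step crosses one hyperplane only, so each step contributes at most 1 to the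
    sum over distinct hyperplanes. *)
Lemma sum_crossing_le (Hs : seq (raag E * V)) g u :
  pairwise (fun H H' => ~~ same_hyp H H') Hs ->
  \sum_(H <- Hs) `|crossing H g u|%N <= size u.
Proof.
move=> dHs; elim: u g => [|a u IH] g /=; first by rewrite big1.
have : \sum_(H <- Hs) (same_hyp H (step_hyp g a)) <= 1.
  elim: Hs dHs {IH} => [_|H Hs IH /= /andP[HHs /IH{}IH]]; rewrite ?big_nil// big_cons.
  case: (boolP (same_hyp _ _)) => // Ha; rewrite big_seq big1 ?addn0// => H' H'Hs.
  apply/eqP; rewrite eqb0; apply/negP => H'a; have /allP/(_ _ H'Hs)/negP := HHs.
  by apply; apply: same_hyp_trans Ha _; rewrite same_hyp_sym.
have := IH (g * elt [:: a]); move=> I1 I2.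
apply: leq_trans (leq_add I2 I1); rewrite -big_split /=.
apply: leq_sum => H _; rewrite /step_sign.
by case: (same_hyp _ _); case: (a.2); lia.
Qed.

End Hyperplanes.

(** * Lines with strongly separated hyperplanes *)

Section CoconnectedLine.
Local Open Scope group_scope.
Context {V : finType} {E : rel V}.
Hypotheses (symE : symmetric E) (irrE : irreflexive E).
Variables (x : nat -> V) (l : nat).
Hypothesis nonadjx : forall i, ~~ E (x i) (x i.+1).
Hypothesis coverx : forall j z, exists2 i, j <= i < j + l & x i = z.
Implicit Types (g s t p : raag E) (u : seq (V * bool)).

Definition line_word i n : seq (V * bool) := [seq (x k, true) | k <- iota i n].

Definition line i : raag E := elt (line_word 0 i).

Lemma line_word_cat i m n :
  line_word i (m + n) = line_word i m ++ line_word (i + m) n.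
Proof. by rewrite /line_word iotaD map_cat. Qed.

Lemma size_line_word i n : size (line_word i n) = n.
Proof. by rewrite size_map size_iota. Qed.

Lemma lineD i n : line (i + n) = line i * elt (line_word i n).
Proof. by rewrite /line line_word_cat elt_cat. Qed.

Lemma line_le i k : i <= k -> line k = line i * elt (line_word i (k - i)).
Proof. by move=> ik; rewrite -lineD subnKC. Qed.

Lemma wlen_line i n : wlen (elt (line_word i n) : raag E) = n.
Proof.
apply/eqP; rewrite eqn_leq -{2}(size_line_word i n) wlen_elt /=.
have := expo_wlen (E := E) predT (line_word i n).
suff -> : expo predT (line_word i n) = Posz n by lia.
elim: n i => [|n IH] i; first by rewrite /expo big_nil.
by rewrite /expo big_cons -/(expo _ _) IH.
Qed.

Lemma crossing_line_ge0 H g i n : (0 <= crossing H g (line_word i n))%R.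
Proof.
elim: n i g => //= n IH i g; apply: addr_ge0; last exact: IH.
by case: ifP.
Qed.

Definition line_hyp i := (line i, x i).

(** All the letters of the line are positive, so no later step can undo a
    crossing. *)
Lemma crossing_line_gt0 i j n : j <= i < j + n ->
  (0 < crossing (line_hyp i) (line j) (line_word j n))%R.
Proof.
move=> /andP[ji ijn]; have -> : n = (i - j) + (n - (i - j)).-1.+1 by lia.
rewrite line_word_cat subnKC// crossing_cat -line_le//=.
rewrite /step_hyp /= same_hyp_refl /step_sign/=.
have := crossing_line_ge0 (line_hyp i) (line j) j (i - j).
have := crossing_line_ge0 (line_hyp i) (line i * elt [:: (x i, true)]) i.+1 (n - (i - j)).-1.
by rewrite /line_word; lia.
Qed.

(** The hyperplane just before the [i]-th one separates [line j] from [line i].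
    Its label is not adjacent to [x i], so the path for [t] cannot cross it and
    the path for [s] does; the claim then follows by induction on [i]. *)
Lemma carriers_disjoint i j s t : j < i ->
  parabolic (E (x j)) s -> parabolic (E (x i)) t -> line j * s * t <> line i.
Proof.
elim: i s t => // i IH s t; rewrite ltnS => ji [S Sj <-] [T Ti <-].
rewrite (@line_le j i.+1) 1?ltnW// -mulgA => /mulgI; rewrite -elt_cat => STE.
have /crossing_line_gt0 : j <= i < j + (i.+1 - j) by lia.
rewrite -(crossing_elt symE _ _ STE) crossing_cat.
rewrite (crossing_letters _ Ti) ?addr0; last by rewrite /= symE nonadjx.
move=> /lt0r_neq0 c0.
have [ji'|ji'] := eqVneq i j.
  by move: c0; rewrite (crossing_letters _ Sj) ?eqxx// ji' /= irrE.
have [S1 [S2 [SE /parabolicV/= par]]] := crossing_carrier c0.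
apply: (IH (elt S1) _ _ _ par); first by rewrite ltn_neqAle eq_sym ji'.
  by exists S1 => //; move: Sj; rewrite SE all_cat => /andP[].
by rewrite invgM invgK mulVKg.
Qed.

(** This says that no hyperplane labelled [z] meets two hyperplanes of the line
    that are a full turn apart. The label [z] occurs on the line in between, at
    [i] say. The hyperplane there must be crossed by the path for [s] or for
    [s'], both of which [carriers_disjoint] excludes, or by the path for [t],
    whose letters are adjacent to [z]. *)
Lemma strongly_separated j k z s t s' : j + l <= k -> E (x j) z ->
  parabolic (E (x j)) s -> parabolic (E z) t -> parabolic (E (x k)) s' ->
  E (x k) z -> line j * s * t * s' <> line k.
Proof.
move=> jk jz [S Sj <-] [T Tz <-] [S' Sk' <-] kz.
have [i /andP[ji ijl] iz] := coverx j z.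
have {}ji : j < i.
  by rewrite ltn_neqAle ji andbT; apply: contraTneq jz => ->; rewrite iz irrE.
have ik : i < k := leq_trans ijl jk.
have jk' : j <= k := ltnW (ltn_trans ji ik).
rewrite (line_le jk') -!mulgA => /mulgI.
rewrite -(elt_cat T) -(elt_cat S) => WE.
have /crossing_line_gt0 : j <= i < j + (k - j) by lia.
rewrite -(crossing_elt symE _ _ WE) !crossing_cat => c0.
have kE : line j * elt S * elt T * elt S' = line k.
  by rewrite (line_le jk') -WE !elt_cat !mulgA.
have cS : crossing (line_hyp i) (line j) S = 0%R.
  apply/eqP/negPn/negP => /crossing_carrier[S1 [S2 [SE /parabolicV/= par]]].
  apply: (carriers_disjoint ji _ par (s := elt S1)).
    by exists S1 => //; move: Sj; rewrite SE all_cat => /andP[].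
  by rewrite invgM invgK mulVKg.
have cT : crossing (line_hyp i) (line j * elt S) T = 0%R.
  by apply: (crossing_letters _ Tz); rewrite /= iz irrE.
move: c0; rewrite cS cT !add0r => /lt0r_neq0.
move=> /crossing_carrier[S1 [S2 [SE /= par]]].
apply: (carriers_disjoint ik par (t := elt S2)).
  by exists S2 => //; move: Sk'; rewrite SE all_cat => /andP[].
by rewrite mulVKg -kE SE elt_cat !mulgA.
Qed.

(** The geodesic from [line j] to [line j * s] crosses [wlen s] hyperplanes, all
    of which meet the [j]-th one. None of them meets the hyperplane a full turn
    later, so every path to the carrier of the latter crosses all of them, apart
    from the at most [l] ones that separate [line j] from [line (j + l)]. *)
Lemma wlen_le_crossing_path j s s' u :
  parabolic (E (x j)) s -> parabolic (E (x (j + l))) s' ->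
  line j * s * elt u = line (j + l) * s' -> wlen s <= size u + l.
Proof.
move=> sj [S' Sk' <-]; have [S [Sj <- sizeS]] := parabolic_word sj.
rewrite lineD -!mulgA => /mulgI.
rewrite -(elt_cat S) -(elt_cat _ S') => pE.
have gS : geodesic (E := E) S by [].
have dS := geodesic_hyps irrE (line j) gS.
have sizeH : size (path_hyps (line j) S) = size S.
  by elim: (S) (line j) => //= a S0 IH g; rewrite IH.
rewrite -sizeS -sizeH; apply: leq_trans (leq_add (sum_crossing_le (line j * elt S) u dS) _).
2: by rewrite -{2}(size_line_word j l); exact: (sum_crossing_le (line j) _ dS).
rewrite -big_split /= -sum1_size big_seq [X in _ <= X]big_seq.
apply: leq_sum => H HS; have <- := crossing_hyps dS HS.
have [S1 [a [S2 [SE HE]]]] : exists S1 a S2,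
    S = S1 ++ a :: S2 /\ H = step_hyp (line j * elt S1) a.
  move: HS; elim: (S) (line j) => //= a S0 IH g; rewrite inE => /orP[/eqP->|].
    by exists [::], a, S0; rewrite elt_nil mulg1.
  move=> /IH[S1 [b [S2 [-> ->]]]]; exists (a :: S1), b, S2.
  by rewrite [elt (a :: S1)]elt_cons mulgA.
have /and3P[S1j aj _] : [&& all (E (x j) \o fst) S1, E (x j) a.1 & all (E (x j) \o fst) S2].
  by move: Sj; rewrite SE all_cat.
have [s1 s1j H1] : exists2 s1, parabolic (E (x j)) s1 & H.1 = line j * s1.
  have S1P : parabolic (E (x j)) (elt S1 : raag E) by exists S1.
  rewrite HE /step_hyp /=; case: a.2; first by exists (elt S1).
  exists (elt S1 * elt [:: a]); last by rewrite mulgA.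
  by apply: parabolicM S1P _; exact: parabolic_letter.
have H2 : H.2 = a.1 by rewrite HE.
have c0 : crossing H (line (j + l)) S' = 0%R.
  apply/eqP/negPn/negP => c1.
  have kz : E (x (j + l)) H.2.
    apply: contraNT c1 => kz; exact/eqP/(crossing_letters _ Sk').
  have [T1 [T2 [S'E par]]] := crossing_carrier c1.
  apply: (@strongly_separated j (j + l) H.2 s1 _ (elt T1)^-1 _ _ s1j par _ kz) => //.
  - by rewrite H2.
  - apply: parabolicV; exists T1 => //.
    by move: Sk'; rewrite S'E all_cat => /andP[].
  - by rewrite H1 mulVKg mulgK.
have := crossing_elt symE H (line j) pE; rewrite !crossing_cat -lineD c0 addr0.
lia.
Qed.

(** The path crosses the hyperplanes [j], [j + l], up to [j + n * l] one after the
    other. It meets the carrier of each of them at distance at least [r] from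
    [line m], and [wlen_le_crossing_path] bounds from below the length of the
    portion from there to the next one. *)
Lemma path_along_line_length (m h r : nat) n j p u k :
  parabolic (E (x j)) ((line j)^-1 * p) -> p * elt u = line k ->
  m <= j -> j + n * l <= m + h -> j + n * l < k ->
  (forall i, r <= wlen ((line m)^-1 * (p * elt (take i u)))) ->
  n * (r - h - l) <= size u.
Proof.
elim: n j p u => // n IH j p u pj uE mj jnh jnk far.
have [s pE] : exists s, p = line j * s by exists ((line j)^-1 * p); rewrite mulVKg.
move: pj; rewrite pE mulKg => pj.
have jlk : j + l < k by move: jnk; rewrite mulSn; lia.
have c0 : (0 < crossing (line_hyp (j + l)) (line j) (line_word j (k - j)))%R.
  by apply: crossing_line_gt0; lia.
have [W Wj WE] := pj.
have c1 : crossing (line_hyp (j + l)) p (word_inv W) = 0%R.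
  apply/eqP/negPn/negP => /crossing_carrier[S1 [S2 [SE /parabolicV/= par]]].
  have S1j : all (E (x j) \o fst) S1.
    have : all (E (x j) \o fst) (word_inv W).
      by rewrite all_rev all_map; apply: sub_all Wj; case.
    by rewrite SE all_cat => /andP[].
  apply: (@carriers_disjoint (j + l) j (s * elt S1) _ _ _ par).
  - case: (posnP l) => [l0|]; last by lia.
    by have [i] := coverx j (x j); rewrite l0 addn0; lia.
  - by apply: parabolicM pj _; exists S1.
  - by rewrite (mulgA (line j)) -pE invgM invgK mulVKg.
have uW : elt u = elt (word_inv W ++ line_word j (k - j)) :> raag E.
  apply: (mulgI p); rewrite uE elt_cat elt_inv WE mulgA pE mulgK -line_le//.
  by lia.
have /lt0r_neq0/crossing_carrier[u1 [u2 [uE12 par]]] :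
    (0 < crossing (line_hyp (j + l)) p u)%R.
  by rewrite (crossing_elt symE _ _ uW) crossing_cat c1 add0r elt_inv WE pE mulgK.
have su1 : wlen s <= size u1 + l.
  apply: (@wlen_le_crossing_path j s _ u1 pj par).
  by rewrite /= mulVKg -pE.
have rs : r <= h + wlen s.
  have := far 0%N; rewrite take0 elt_nil mulg1 pE (line_le mj) -mulgA mulKg.
  move=> /leq_trans-/(_ _ (wlenM _ _)); rewrite wlen_line; lia.
have : n * (r - h - l) <= size u2.
  apply: (IH (j + l) (p * elt u1)) => //.
  - by rewrite -mulgA -elt_cat -uE12.
  - lia.
  - by move: jnh; rewrite mulSn; lia.
  - by move: jnk; rewrite mulSn; lia.
  - move=> i; have := far (size u1 + i).
    by rewrite uE12 take_cat ltnNge leq_addr /= addKn elt_cat (mulgA p).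
by rewrite uE12 size_cat mulSn; lia.
Qed.

(** The path has to cross the [m]-th hyperplane, and [path_along_line_length]
    applies to what follows this crossing. *)
Lemma detour_length (m r n : nat) u k :
  elt u = line k -> m + n * l < k ->
  (forall i, r <= wlen ((line m)^-1 * elt (take i u))) ->
  n * (r - n * l - l) <= size u.
Proof.
move=> uE mnk far.
have mk : m < k by apply: leq_ltn_trans mnk; rewrite leq_addr.
have /crossing_line_gt0 : 0 <= m < 0 + k by rewrite mk.
rewrite -(crossing_elt symE _ _ uE) => /lt0r_neq0/crossing_carrier[u1 [u2 [uE12 par]]].
have : n * (r - n * l - l) <= size u2.
  apply: (@path_along_line_length m (n * l) r n m (elt u1) u2 k) => //.
  - by move: par; rewrite /line /= elt_nil mul1g.
  - by rewrite -elt_cat -uE12.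
  - move=> i; have := far (size u1 + i).
    by rewrite uE12 take_cat ltnNge leq_addr /= addKn elt_cat.
by rewrite uE12 size_cat; lia.
Qed.

End CoconnectedLine.

Section CoconnectedWalk.
Context {V : finType} {E : rel V}.
Hypothesis irrE : irreflexive E.

Lemma nonjoin_connected : ~ is_join E -> forall x y, connect (fun a b => ~~ E a b) x y.
Proof.
move=> nj x y; apply/negPn/negP => nxy; apply: nj.
exists [set z | connect (fun a b => ~~ E a b) x z]%SET; split.
- by apply/finset.set0Pn; exists x; rewrite finset.inE connect0.
- by apply/finset.set0Pn; exists y; rewrite !finset.inE.
- move=> a b; rewrite !finset.inE => xa; apply: contraR => ab.
  by apply: connect_trans xa _; exact: connect1.
Qed.

(** The complement of a graph that is not a join is connected, so it has a closed
    walk through all the vertices, which is repeated forever. *)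
Lemma nonjoin_walk : ~ is_join E -> 0 < #|V| -> exists (x : nat -> V) (l : nat),
  (forall i, ~~ E (x i) (x i.+1)) /\
  (forall j z, exists2 i, j <= i < j + l & x i = z).
Proof.
move=> /nonjoin_connected conE /card_gt0P[x0 _].
pose e a b := ~~ E a b.
have [p xp pV] : exists2 p, path e x0 p & forall z, z \in p.
  suff [p xp ps] : exists2 p, path e x0 p & forall z, z \in enum V -> z \in p.
    by exists p => // z; apply: ps; rewrite mem_enum.
  elim: (enum V) => [|y s [p xp ps]]; first by exists [::].
  have [q pq qy] : exists2 q, path e (last x0 p) q & y \in q.
    have [yp|yp] := eqVneq y (last x0 p).
      by exists [:: y]; rewrite ?mem_head//= yp /e irrE.
    have /connectP[q pq qy] := conE (last x0 p) y; exists q => //.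
    by case: q pq qy => [|a q] _ /= qy; [rewrite qy eqxx in yp|rewrite qy mem_last].
  exists (p ++ q); first by rewrite cat_path xp.
  move=> z; rewrite inE mem_cat => /orP[/eqP->|/ps->//]; by rewrite qy orbT.
have /connectP[q pq qx] := conE (last x0 p) x0.
set w := p ++ q; have w0 : 0 < size w.
  by rewrite size_cat; case: (p) (pV x0).
have xw : path e x0 w by rewrite cat_path xp.
have lw : last x0 w = x0 by rewrite last_cat -qx.
exists (fun i => nth x0 w (i %% size w)), (size w); split=> [i|j z].
  have iw : i %% size w < size w by rewrite ltn_pmod.
  have /(pathP x0) wP := xw.
  have [im|im] := eqVneq (i %% size w).+1 (size w).
    have -> : i.+1 %% size w = 0.
      by rewrite -addn1 -modnDml addn1 im modnn.
    have := wP 0 w0; rewrite /= -[i %% size w]/((i %% size w).+1.-1) im.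
    by rewrite nth_last lw.
  have iw' : (i %% size w).+1 < size w by rewrite ltn_neqAle im.
  have -> : i.+1 %% size w = (i %% size w).+1.
    by rewrite -addn1 -modnDml addn1 modn_small.
  exact: wP _ iw'.
have zw : index z w < size w by rewrite index_mem mem_cat pV.
exists (j + (index z w + (size w - j %% size w)) %% size w).
  by rewrite leq_addr ltn_add2l ltn_pmod.
rewrite modnDmr -modnDml addnCA subnKC; last by rewrite ltnW ?ltn_pmod.
by rewrite modnDr modn_small// nth_index// mem_cat pV.
Qed.

End CoconnectedWalk.

(** * Distance and paths in graphs *)

Section GraphDistance.
Context {G : connected_graph}.
Implicit Types (x y z : G) (p : seq G) (D : pred G) (m n : nat).

Lemma ex_graph_path x y :
  exists n, `[< exists p, [/\ path (@adj G) x p, last x p = y & size p = n] >].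
Proof.
by have [p xp py] := adj_conn x y; exists (size p); apply/asboolP; exists p.
Qed.

Definition gdist x y : nat := ex_minn (ex_graph_path x y).

Lemma gdist_path x y :
  exists p, [/\ path (@adj G) x p, last x p = y & size p = gdist x y].
Proof. by rewrite /gdist; case: ex_minnP => n /asboolP. Qed.

Lemma gdist_le x p : path (@adj G) x p -> gdist x (last x p) <= size p.
Proof.
by move=> xp; rewrite /gdist; case: ex_minnP => n _; apply; apply/asboolP; exists p.
Qed.

Lemma gdistxx x : gdist x x = 0.
Proof. by apply/eqP; rewrite -leqn0; apply: (@gdist_le x [::]). Qed.

Lemma gdist_adj x y : adj x y -> gdist x y <= 1.
Proof. by move=> xy; apply: (@gdist_le x [:: y]); rewrite /= xy. Qed.

Lemma gdist_triangle y x z : gdist x z <= gdist x y + gdist y z.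
Proof.
have [p [xp py <-]] := gdist_path x y; have [q [yq qz <-]] := gdist_path y z.
rewrite -size_cat -qz -py -last_cat; apply: gdist_le.
by rewrite cat_path xp py.
Qed.

Lemma rev_adj_path x p : path (@adj G) x p ->
  path (@adj G) (last x p) (rev (belast x p)).
Proof.
by move=> xp; rewrite rev_path; apply: sub_path xp => y z; rewrite adj_sym.
Qed.

Lemma last_rev_belast x p : last (last x p) (rev (belast x p)) = x.
Proof. by case: p => //= y p; rewrite rev_cons last_rcons. Qed.

Lemma gdist_sym x y : gdist x y = gdist y x.
Proof.
suff H u v : gdist v u <= gdist u v by apply/eqP; rewrite eqn_leq !H.
have [p [up <- <-]] := gdist_path u v.
rewrite -{2}(last_rev_belast u p) -(size_belast u p) -size_rev.
exact/gdist_le/rev_adj_path.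
Qed.

Definition joined D n x y : Prop :=
  exists p, [/\ path (@adj G) x p, last x p = y, size p <= n & all D (x :: p)].

Lemma joined_refl D x : D x -> joined D 0 x x.
Proof. by exists [::]; rewrite /= andbT. Qed.

Lemma joined_trans D y x z m n :
  joined D m x y -> joined D n y z -> joined D (m + n) x z.
Proof.
move=> [p [xp py pm Dp]] [q [yq qz qn /= /andP[_ Dq]]]; exists (p ++ q); split.
- by rewrite cat_path xp py.
- by rewrite last_cat py.
- by rewrite size_cat leq_add.
- by rewrite -cat_cons all_cat Dp.
Qed.

Lemma joined_sym D n x y : joined D n x y -> joined D n y x.
Proof.
move=> [p [xp <- pn Dp]]; exists (rev (belast x p)); split.
- exact: rev_adj_path.
- exact: last_rev_belast.
- by rewrite size_rev size_belast.
- by rewrite -rev_rcons -lastI all_rev.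
Qed.

Lemma joined_leq D m n x y : m <= n -> joined D m x y -> joined D n x y.
Proof. by move=> mn [p [? ? /leq_trans-/(_ _ mn) ? ?]]; exists p. Qed.

Lemma joined_sub D D' n x y :
  (forall v, D v -> D' v) -> joined D n x y -> joined D' n x y.
Proof. by move=> DD [p [? ? ? Dp]]; exists p; split=> //; exact: sub_all Dp. Qed.

Lemma joined_gdist x y : joined (fun v => gdist x v <= gdist x y) (gdist x y) x y.
Proof.
have [p [xp py sp]] := gdist_path x y; exists p; split; rewrite ?sp//.
apply/allP => v; rewrite inE => /orP[/eqP->|]; first by rewrite gdistxx.
move=> vp; case/splitPr: vp xp sp {py} => p1 p2 xp <-.
move: xp; rewrite -cat1s catA cat_path => /andP[xp1 _].
have := gdist_le xp1; rewrite last_cat /= => /leq_trans; apply.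
by rewrite !size_cat /=; lia.
Qed.

End GraphDistance.

(** * Lipschitz curves and fine partitions *)

Section LipschitzCurves.
Local Open Scope classical_set_scope.
Local Open Scope ring_scope.
Context {R : realType} {X : metricType R}.
Implicit Types (a b c p : X) (l : R) (D : set X).

(** Curves parametrized at speed at most 1 are easy to concatenate, and continuity
    and the bound on the length come for free. *)
Definition lip_joined D l a b : Prop := exists f : R -> X,
  [/\ 0 <= l, f 0 = a, f l = b,
    forall s t, 0 <= s <= t -> t <= l -> mdist (f s) (f t) <= t - s &
    forall s, 0 <= s <= l -> D (f s)].

Lemma lip_joined_refl D a : D a -> lip_joined D 0 a a.
Proof.
exists (fun=> a); split=> // s t /andP[s0 st] tl.
by rewrite mdistxx subr_ge0.
Qed.

Lemma lip_joined_sub D D' l a b :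
  (forall p, D p -> D' p) -> lip_joined D l a b -> lip_joined D' l a b.
Proof. by move=> DD [f [? ? ? ? H]]; exists f; split=> // s /H/DD. Qed.

Lemma lip_joined_sym D l a b : lip_joined D l a b -> lip_joined D l b a.
Proof.
move=> [f [l0 fa fb flip fD]]; exists (fun t => f (l - t)); split=> //.
- by rewrite subr0.
- by rewrite subrr.
- move=> s t /andP[s0 st] tl; rewrite metric_sym.
  have -> : t - s = (l - s) - (l - t) by ring.
  by apply: flip; lra.
- by move=> s ?; apply: fD; lra.
Qed.

Lemma lip_joined_trans D b a c l m :
  lip_joined D l a b -> lip_joined D m b c -> lip_joined D (l + m) a c.
Proof.
move=> [f [l0 fa fb flip fD]] [g [m0 gb gc glip gD]].
exists (fun t => if t <= l then f t else g (t - l)); split.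
- exact: addr_ge0.
- by rewrite l0.
- case: ifP => lml; last by rewrite addrAC subrr add0r.
  have m0' : m = 0 by lra.
  by rewrite -gc m0' addr0 fb gb.
- move=> s t /andP[s0 st] tlm; case: (leP t l) => tl.
    by rewrite (le_trans st tl); apply: flip => //; rewrite s0.
  case: (leP s l) => sl; last first.
    have -> : t - s = (t - l) - (s - l) by ring.
    by apply: glip; lra.
  apply: le_trans (metric_triangle _ b _) _.
  have -> : t - s = (l - s) + ((t - l) - 0) by ring.
  apply: lerD; first by rewrite -fb; apply: flip; lra.
  by rewrite -gb; apply: glip; lra.
- move=> s /andP[s0 slm]; case: (leP s l) => sl; first by apply: fD; lra.
  by apply: gD; lra.
Qed.

Fixpoint polygon_length (g : R -> X) x s : R :=
  if s is y :: s' then mdist (g x) (g y) + polygon_length g y s' else 0.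

Lemma polygon_lengthE (g : R -> X) x s :
  \sum_(i < size s) mdist (g (nth 0 (x :: s) i)) (g (nth 0 s i)) =
  polygon_length g x s.
Proof.
elim: s x => [|y s IH] x /=; first by rewrite big_ord0.
by rewrite big_ord_recl /= IH.
Qed.

Lemma path_lt_le_last (x : R) s : path <%R x s -> x <= last x s.
Proof.
elim: s x => //= y s IH x /andP[xy /IH]; apply: le_trans; exact: ltW.
Qed.

Lemma div_le_lip (rho : R -> R) a b c l :
  lip_joined [set p | rho (dist_to_pair c a b) <= mdist c p] l a b ->
  (div rho a b c <= l%:E)%E.
Proof.
move=> [f [l0 fa fb flip fD]].
have lip s t : 0 <= s -> s <= t -> t <= 1 ->
    mdist (f (l * s)) (f (l * t)) <= l * (t - s).
  move=> s0 st t1; rewrite mulrBr; apply: flip; last by rewrite ler_piMr.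
  by rewrite mulr_ge0//= ler_wpM2l.
apply: (@le_trans _ _ (curve_length (fun t => f (l * t)))).
  apply: ereal_inf_lbound; exists (fun t => f (l * t)) => //; split; last first.
    move=> t; rewrite in_itv/= => /andP[t0 t1]; apply: fD.
    by rewrite mulr_ge0//= ler_piMr.
  split; rewrite ?mulr0 ?mulr1//.
  apply/subspace_continuousP => s; rewrite /= in_itv/= => /andP[s0 s1].
  apply/metricType_numDomainType.cvgrPdist_lt => e e0; rewrite near_withinE.
  have l1 : 0 < l + 1 by rewrite ltr_wpDl.
  apply/nbhs_ballP; exists (e / (l + 1)) => /=; first by rewrite divr_gt0.
  move=> t; rewrite /ball/= ltr_pdivlMr// => st; rewrite in_itv/= => /andP[t0 t1].
  apply: le_lt_trans st; case: (leP s t) => st.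
    apply: le_trans (lip _ _ s0 st t1) _; rewrite mulrC distrC.
    by apply: ler_pM; rewrite ?subr_ge0 ?ler_norm// lerDl.
  rewrite metric_sym; apply: le_trans (lip _ _ t0 (ltW st) s1) _; rewrite mulrC.
  by apply: ler_pM; rewrite ?subr_ge0 ?ler_norm ?(ltW st)// lerDl.
apply: ge_ereal_sup => _ [s /= [s01 /eqP sl] <-]; rewrite lee_fin.
rewrite (polygon_lengthE (fun t => f (l * t))).
suff H (x : R) : 0 <= x -> path <%R x s -> last x s <= 1 ->
    polygon_length (fun t => f (l * t)) x s <= l * (last x s - x).
  by have := H _ (lexx 0) s01; rewrite sl subr0 mulr1 => /(_ (lexx _)).
elim: s x {s01 sl} => [|y s IH] x /= x0; first by rewrite subrr mulr0.
move=> /andP[xy ys] s1; have y0 : 0 <= y by exact: le_trans (ltW xy).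
have -> : l * (last y s - x) = l * (y - x) + l * (last y s - y) by ring.
apply: lerD (IH _ y0 ys s1); apply: lip => //; first exact: ltW.
exact: le_trans (path_lt_le_last ys) s1.
Qed.

(** The supremum of the times that can be reached by short steps is itself
    reached, by continuity there, and cannot be less than 1. *)
Lemma fine_partition (g : R -> X) (e : R) : {within `[0, 1], continuous g} ->
  0 < e -> exists2 s, itv_partition 0 1 s &
    path (fun x y => mdist (g x) (g y) < e) 0 s.
Proof.
move=> /subspace_continuousP gC e0.
pose ok x s := path <%R 0 s /\ path (fun x y => mdist (g x) (g y) < e) 0 s /\
  last 0 s = x.
pose A := [set x | x <= 1 /\ exists s, ok x s].
have A0 : A 0 by split=> //; exists [::].
have supA : has_sup A by split; [exists 0|exists 1 => x []].
set c := sup A; have c0 : 0 <= c by apply: ub_le_sup => //; case: supA.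
have c1 : c <= 1 by apply: ge_sup; [exists 0|move=> x []].
have := gC c; rewrite /= in_itv/= c0 c1 => /(_ isT).
move=> /metricType_numDomainType.cvgrPdist_lt /(_ (e / 2)); rewrite divr_gt0// => /(_ isT).
rewrite near_withinE => /nbhs_ballP[d /= d0 cd].
have near t : 0 <= t <= 1 -> `|c - t| < d -> mdist (g c) (g t) < e / 2.
  by move=> t01 ct; apply: cd => //; rewrite /= in_itv.
have [x [x1 [s [s1 [s2 sx]]]] cx] : exists2 x, A x & c - d < x.
  by apply: sup_adherent.
have x0 : 0 <= x by rewrite -sx; exact: path_lt_le_last.
have xc : x <= c by apply: ub_le_sup; [case: supA|split=> //; exists s].
have step t : x < t -> t <= 1 -> `|c - t| < d -> A t.
  move=> xt t1 ct; split=> //; exists (rcons s t); split; last split.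
  - by rewrite rcons_path s1 sx.
  - rewrite rcons_path s2 sx /= (splitr e).
    apply: le_lt_trans (metric_triangle _ (g c) _) _; apply: ltrD.
      rewrite metric_sym; apply: near; first by rewrite x0.
      by rewrite ger0_norm ?subr_ge0//; lra.
    by apply: near => //; rewrite t1 (le_trans x0 (ltW xt)).
  - by rewrite last_rcons.
case: (ltP c 1) => cl1.
  pose t := Num.min 1 (c + d / 2).
  have ct : c < t by rewrite /t lt_min cl1/= ltrDl divr_gt0.
  have : A t.
    apply: step; first exact: le_lt_trans ct.
      by rewrite /t ge_min lexx.
    rewrite distrC ger0_norm ?subr_ge0 ?(ltW ct)//.
    have : t <= c + d / 2 by rewrite /t ge_min lexx orbT.
    lra.
  move=> /(ub_le_sup (proj2 supA)); rewrite -/c; lra.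
have c1E : c = 1 by apply/le_anti; rewrite c1.
have [s' [p1 [p2 p3]]] : exists s, ok 1 s.
  case: (ltP x 1) => xl1; last first.
    by exists s; split=> //; split=> //; rewrite sx; apply/le_anti; rewrite x1.
  by case: (step 1) => //; rewrite c1E subrr normr0.
by exists s' => //; split=> //; apply/eqP.
Qed.

Lemma polygon_le_curve_length (g : R -> X) s : itv_partition 0 1 s ->
  ((polygon_length g 0 s)%:E <= curve_length g)%E.
Proof.
by move=> s01; rewrite -polygon_lengthE; apply: ereal_sup_ubound; exists s.
Qed.

End LipschitzCurves.

(** * Geometry of the realization of a graph *)

Section RealizationGeometry.
Local Open Scope classical_set_scope.
Local Notation coord := Defs.coord.
Local Open Scope ring_scope.
Context {R : realType} {G : connected_graph}.
Implicit Types (x y z v : G) (p q : realization R G) (s t l : R) (f : G -> R).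

(** Both sides are the sum of [f] against the barycentric coordinates. *)
Lemma interpolation_unique f x y s x' y' s' :
  edge_point x y s = edge_point x' y' s' :> (G -> R) ->
  (1 - s) * f x + s * f y = (1 - s') * f x' + s' * f y'.
Proof.
pose r := undup [:: x; y; x'; y'].
have delta u : u \in r -> \sum_(z <- r) (z == u)%:R * f z = f u.
  move=> ur; rewrite (bigD1_seq u) ?undup_uniq//= eqxx mul1r big1 ?addr0// => z.
  by move=> /negbTE->; rewrite mul0r.
have sumE u w c : u \in r -> w \in r ->
    \sum_(z <- r) edge_point u w c z * f z = (1 - c) * f u + c * f w.
  move=> ur wr; rewrite -[in RHS](delta u ur) -[in RHS](delta w wr).
  rewrite !mulr_sumr -big_split /=; apply: eq_bigr => z _.
  by rewrite /edge_point; ring.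
move=> e; rewrite -!sumE ?mem_undup ?inE ?eqxx ?orbT//.
by rewrite e.
Qed.

Lemma interpolation_exists f p : exists c : R, forall x y s,
  coord p = edge_point x y s -> c = (1 - s) * f x + s * f y.
Proof.
have [x [y [s [_ _ pE]]]] := coordP p.
exists ((1 - s) * f x + s * f y) => x' y' s' pE'.
by apply: interpolation_unique; rewrite -pE -pE'.
Qed.

(** The extension that is affine on the edges. For a function that is 1-Lipschitz
    on the vertices it is 1-Lipschitz, which shows that the realization has no
    shortcuts between vertices. *)
Definition interpolate f p : R := sval (cid (interpolation_exists f p)).

Lemma interpolateE f p x y s : coord p = edge_point x y s ->
  interpolate f p = (1 - s) * f x + s * f y.
Proof. by rewrite /interpolate; case: cid => c /= cE /cE. Qed.

Lemma interpolate_vpoint f x : interpolate f (vpoint x) = f x.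
Proof. by rewrite (@interpolateE _ _ x x 0)//; ring. Qed.

Lemma interpolate_lip f : (forall x y, adj x y -> `|f x - f y| <= 1) ->
  forall p q, `|interpolate f p - interpolate f q| <= mdist p q.
Proof.
move=> f1 p q; apply: path_dist_ge => l; elim=> [p'|]; first by rewrite subrr normr0.
move=> x y s t p' q' r l' xy s01 t01 p'E q'E _ IH.
apply: le_trans (ler_distD (interpolate f q') _ _) _; apply: lerD IH.
rewrite (interpolateE f p'E) (interpolateE f q'E).
have -> : (1 - s) * f x + s * f y - ((1 - t) * f x + t * f y) =
  (s - t) * (f y - f x) by ring.
by rewrite normrM ler_piMr// distrC f1.
Qed.

Lemma mdist_edge x y s t p q : adj x y -> s \in `[0, 1] -> t \in `[0, 1] ->
  coord p = edge_point x y s -> coord q = edge_point x y t ->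
  mdist p q <= `|s - t|.
Proof.
move=> xy s01 t01 pE qE; apply: path_dist_le; rewrite -[`|_|]addr0.
exact: (pl_cons xy s01 t01 pE qE (pl_nil q)).
Qed.

Lemma vpoint_edge0 x y : coord (vpoint x : realization R G) = edge_point x y 0.
Proof. by rewrite (edge_point0 x y). Qed.

Lemma vpoint_edge1 x y : coord (vpoint y : realization R G) = edge_point x y 1.
Proof. by rewrite (edge_point1 x y). Qed.

Let i01 : 0 \in `[0, 1 : R]. Proof. by rewrite bound_itvE. Qed.

Let i11 : 1 \in `[0, 1 : R]. Proof. by rewrite bound_itvE. Qed.

Lemma mdist_adj x y : adj x y -> mdist (vpoint x : realization R G) (vpoint y) <= 1.
Proof.
move=> xy; have -> : 1 = `|0 - 1| :> R by rewrite sub0r normrN normr1.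
exact: mdist_edge xy i01 i11 (vpoint_edge0 x y) (vpoint_edge1 x y).
Qed.

Lemma mdist_vpoint x y : mdist (vpoint x : realization R G) (vpoint y) = (gdist x y)%:R.
Proof.
apply/le_anti/andP; split; last first.
  have lip u v : adj u v -> `|(gdist x u)%:R - (gdist x v)%:R| <= 1 :> R.
    move=> uv; have := gdist_adj uv; have := gdist_triangle u x v.
    have := gdist_triangle v x u; rewrite (gdist_sym v u) => a b c.
    have a' : (gdist x u <= gdist x v + 1)%N by lia.
    have b' : (gdist x v <= gdist x u + 1)%N by lia.
    move: a' b'; rewrite -!(ler_nat R) !natrD => a' b'.
    by rewrite ler_norml; apply/andP; split; lra.
  have := interpolate_lip lip (vpoint x) (vpoint y).
  by rewrite !interpolate_vpoint gdistxx sub0r normrN ger0_norm.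
have [p [xp <- <-]] := gdist_path x y.
elim: p x xp => [|z p IH] x /=; first by rewrite mdistxx.
move=> /andP[xz /IH zp]; apply: le_trans (metric_triangle _ (vpoint z) _) _.
by rewrite mulrS; apply: lerD zp; exact: mdist_adj.
Qed.

Lemma edge_near_vertex x y s p : (x == y) || adj x y -> s \in `[0, 1] ->
  coord p = edge_point x y s ->
  exists2 v, v \in [:: x; y] & mdist p (vpoint v) <= 1 / 2.
Proof.
case/orP => [/eqP<- _ pE|xy s01 pE].
  exists x; rewrite ?mem_head//.
  have -> : p = vpoint x by apply: coord_inj; rewrite pE edge_pointxx.
  by rewrite mdistxx; lra.
move: (s01); rewrite in_itv/= => /andP[s0 s1].
case: (leP s (1/2)) => s2.
  exists x; rewrite ?mem_head//.
  apply: le_trans (mdist_edge xy s01 i01 pE (vpoint_edge0 x y)) _.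
  by rewrite subr0 ger0_norm.
exists y; rewrite ?inE ?eqxx ?orbT//.
apply: le_trans (mdist_edge xy s01 i11 pE (vpoint_edge1 x y)) _.
by rewrite distrC ger0_norm ?subr_ge0//; lra.
Qed.

Lemma near_vertex p : exists v, mdist p (vpoint v) <= 1 / 2.
Proof.
have [x [y [s [xy s01 pE]]]] := coordP p.
by have [v _ ?] := edge_near_vertex xy s01 pE; exists v.
Qed.

Lemma edge_realization x y s : adj x y -> s \in `[0, 1] ->
  in_realization (edge_point x y s : G -> R).
Proof. by move=> xy s01; exists x, y, s; rewrite xy orbT. Qed.

Lemma lip_joined_edge (D : set (realization R G)) x y s t p q :
  adj x y -> 0 <= s <= t -> t <= 1 ->
  coord p = edge_point x y s -> coord q = edge_point x y t ->
  (forall w c, s <= c <= t -> coord w = edge_point x y c -> D w) ->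
  lip_joined D (t - s) p q.
Proof.
move=> xy /andP[s0 st] t1 pE qE Dw.
pose f c : realization R G :=
  if pselect (s + c \in `[0, 1]) is left sc then Realization (edge_realization xy sc)
  else vpoint x.
have fE c : 0 <= c <= t - s -> coord (f c) = edge_point x y (s + c).
  move=> /andP[c0 cts]; rewrite /f; case: pselect => // -[]; rewrite in_itv/=.
  by apply/andP; split; lra.
exists f; split.
- by rewrite subr_ge0.
- by apply: coord_inj; rewrite fE ?addr0 ?lexx ?subr_ge0.
- by apply: coord_inj; rewrite fE ?subr_ge0 ?st ?lexx// addrC subrK.
- move=> c d /andP[c0 cd] dts.
  apply: le_trans (mdist_edge xy _ _ (fE c _) (fE d _)) _.
  + by rewrite in_itv/=; apply/andP; split; lra.
  + by rewrite in_itv/=; apply/andP; split; lra.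
  + by apply/andP; split; lra.
  + by apply/andP; split; lra.
  + by rewrite distrC ger0_norm; lra.
- move=> c /[dup] c0 /fE; apply: Dw; lra.
Qed.


(** A point of an edge is within 1/2 of one of its ends, so a condition on the
    vertices, thickened by 1/2, holds along the edges. *)
Lemma lip_joined_path (P : pred G) (D : set (realization R G)) n x y :
  (forall v q, P v -> mdist q (vpoint v) <= 1 / 2 -> D q) ->
  joined P n x y -> exists2 l, l <= n%:R & lip_joined D l (vpoint x) (vpoint y).
Proof.
move=> PD [s [xs sy sn Ps]]; exists (size s)%:R; first by rewrite ler_nat.
elim: s x xs sy {sn} Ps => [|z s IH] x /=.
  move=> _ -> /andP[Py _]; apply: lip_joined_refl.
  by apply: (PD y) => //; rewrite mdistxx; lra.
move=> /andP[xz zs] sy /and3P[Px Pz Ps].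
rewrite mulrS; apply: lip_joined_trans (IH z zs sy _); last by rewrite /= Pz.
rewrite -[1]subr0; apply: (lip_joined_edge xz _ _ (vpoint_edge0 x z) (vpoint_edge1 x z));
  rewrite ?lexx ?ler01//.
  move=> w c c01 wE.
  have [||v vxz] := edge_near_vertex _ _ wE; rewrite ?xz ?orbT ?in_itv//.
  by apply: PD; move: vxz; rewrite !inE => /orP[] /eqP->.
Qed.

Lemma to_vertex p : exists v l, [/\ l <= 1 / 2, mdist p (vpoint v) <= 1 / 2 &
  lip_joined [set w | mdist w (vpoint v) <= 1 / 2] l p (vpoint v)].
Proof.
have [x [y [s [/orP[/eqP<-|xy] s01 pE]]]] := coordP p.
  have -> : p = vpoint x by apply: coord_inj; rewrite pE edge_pointxx.
  exists x, 0; rewrite mdistxx; split; rewrite ?divr_ge0//.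
  by apply: lip_joined_refl => /=; rewrite mdistxx; lra.
move: (s01); rewrite in_itv/= => /andP[s0 s1].
have [vx vy] := (vpoint_edge0 x y, vpoint_edge1 x y).
case: (leP s (1/2)) => s2.
  have near w c : c <= s -> 0 <= c -> coord w = edge_point x y c ->
      mdist w (vpoint x) <= 1 / 2.
    move=> cs c0 wE; apply: le_trans (mdist_edge xy _ i01 wE vx) _.
      by rewrite in_itv/=; apply/andP; split; lra.
    by rewrite subr0 ger0_norm//; lra.
  exists x, s; split=> //; first exact: (near _ s).
  apply: lip_joined_sym; rewrite -[s]subr0.
  apply: (lip_joined_edge xy _ _ vx pE); rewrite ?lexx//.
  by move=> w c /andP[c0 cs]; apply: near.
have near w c : s <= c -> c <= 1 -> coord w = edge_point x y c ->
    mdist w (vpoint y) <= 1 / 2.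
  move=> sc c1 wE; apply: le_trans (mdist_edge xy _ i11 wE vy) _.
    by rewrite in_itv/=; apply/andP; split; lra.
  by rewrite distrC ger0_norm ?subr_ge0//; lra.
exists y, (1 - s); split; first by lra.
  exact: (near _ s).
apply: (lip_joined_edge xy _ _ pE vy); rewrite ?s0//.
by move=> w c /andP[c0 cs]; apply: near.
Qed.

(** The points of the polygon are rounded to vertices. The current vertex [v] is
    kept as long as it is within 1 of the current point; when it is replaced by
    a vertex within 1/2, the distance drops by at least 1/2, which pays for the
    step in the graph. *)
Lemma round_polygon (g : R -> realization R G) (N : set G) (s : seq R) t0 v :
  path (fun t t' => mdist (g t) (g t') < 1 / 4) t0 s ->
  (forall w t, t \in t0 :: s -> mdist (vpoint w) (g t) <= 1 -> N w) ->
  mdist (vpoint v) (g t0) <= 1 ->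
  exists r, [/\ path (@adj G) v r, forall w, w \in v :: r -> N w,
    mdist (vpoint (last v r)) (g (last t0 s)) <= 1 &
    (size r)%:R / 2 + mdist (vpoint (last v r)) (g (last t0 s)) <=
      mdist (vpoint v) (g t0) + polygon_length g t0 s].
Proof.
elim: s t0 v => [|t1 s IH] t0 v /=.
  move=> _ Nw v0; exists [::]; split=> //=; last by rewrite mul0r add0r addr0.
  by move=> w; rewrite inE => /eqP->; apply: (Nw v t0); rewrite ?mem_head.
move=> /andP[t01 t1s] Nw v0.
have Nw1 w t : t \in t1 :: s -> mdist (vpoint w) (g t) <= 1 -> N w.
  by move=> ts; apply: Nw; rewrite inE ts orbT.
have tri := metric_triangle (vpoint v) (g t0) (g t1).
case: (leP (mdist (vpoint v) (g t1)) 1) => v1.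
  have [r [vr Nr r1 rs]] := IH t1 v t1s Nw1 v1.
  by exists r; split=> //; lra.
have [v' v'1] := near_vertex (g t1); rewrite metric_sym in v'1.
have v'1' : mdist (vpoint v') (g t1) <= 1 by lra.
have [r [vr Nr r1 rs]] := IH t1 v' t1s Nw1 v'1'.
have vv' : adj v v'.
  have : mdist (vpoint v : realization R G) (vpoint v') < 2.
    apply: le_lt_trans (metric_triangle _ (g t1) _) _.
    by rewrite (metric_sym (g t1)); lra.
  rewrite mdist_vpoint -[2]/(2%:R) ltr_nat.
  have [q [vq qv' <-]] := gdist_path v v'.
  case: q vq qv' => [|a [|b q]] //=; last by rewrite andbT => + <-.
  by move=> _ vE; move: v1; rewrite vE; lra.
exists (v' :: r); split=> //=.
- by rewrite vv'.
- move=> w; rewrite inE => /orP[/eqP->|]; last exact: Nr.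
  by apply: (Nw v t0); rewrite ?mem_head.
- by rewrite mulrS; lra.
Qed.

(** Round a fine partition of the curve; the last vertex may have to be corrected
    by one more step. *)
Lemma curve_to_path (g : R -> realization R G) x y l :
  is_curve (vpoint x) (vpoint y) g -> (curve_length g <= l%:E)%E ->
  exists r, [/\ path (@adj G) x r, last x r = y, (size r)%:R <= 2 * l + 1 &
    forall v, v \in x :: r -> exists2 t, t \in `[0, 1] & mdist (vpoint v) (g t) <= 1].
Proof.
move=> [gC g0 g1] gl.
have [|s s01 sg] := fine_partition gC (e := 1 / 4); first by lra.
have sl := le_trans (polygon_le_curve_length g s01) gl; rewrite lee_fin in sl.
pose N v := exists2 t, t \in `[0, 1] & mdist (vpoint v) (g t) <= 1.
have [||r [xr Nr r1 rl]] := @round_polygon g N s 0 x sg.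
- move=> w t ts wt; exists t => //; rewrite in_itv/=.
  have /nthP-/(_ 1)[i] := ts; rewrite [size _]/= => si <-.
  by rewrite (itv_partition_nth_ge si s01) (itv_partition_nth_le si s01).
- by rewrite g0 mdistxx ler01.
have [_ /eqP s1] := s01.
move: r1 rl; rewrite s1 g1 g0 mdistxx add0r mdist_vpoint => r1 rl.
have {}r1 : (gdist (last x r) y <= 1)%N by rewrite -(ler_nat R).
have [q [rq qy sq]] := gdist_path (last x r) y.
exists (r ++ q); split.
- by rewrite cat_path xr.
- by rewrite last_cat.
- have : (size q)%:R <= 1 :> R by rewrite sq (ler_nat R _ 1).
  have := ler0n R (gdist (last x r) y).
  by rewrite size_cat natrD; lra.
- move=> v; rewrite -cat_cons mem_cat => /orP[|vq]; first exact: Nr.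
  have -> : v = y.
    case: q sq qy vq {rq} => [|a [|b q]] //=; last by move=> sq; move: r1; rewrite -sq.
    by rewrite inE => _ -> /eqP.
  by exists 1; rewrite ?bound_itvE// g1 mdistxx ler01.
Qed.

End RealizationGeometry.

(** * Escaping from a ball in a Cayley graph *)

Section CayleyGraph.
Local Open Scope group_scope.
Context {Gp : groupType} {S : seq Gp} (genS : generates S).
Local Notation X := (cayley_graph genS).
Implicit Types (g h k a b c : X) (D : pred X) (n : nat).

Lemma joined_fun D (F : nat -> X) n :
  (forall i, i < n -> adj (F i) (F i.+1)) -> (forall i, i <= n -> D (F i)) ->
  joined D n (F 0) (F n).
Proof.
elim: n => [|n IH] adjF DF; first exact/joined_refl/DF.
apply: (@joined_leq _ _ (n + 1)); first by rewrite addn1.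
apply: joined_trans (IH _ _) _.
- by move=> i ?; apply: adjF; lia.
- by move=> i ?; apply: DF; lia.
exists [:: F n.+1]; split=> //; last by rewrite /= !DF.
by apply/andP; split=> //; exact: adjF.
Qed.

Lemma adj_mull k g h : adj ((k : Gp) * g : X) ((k : Gp) * h : X) = adj g h.
Proof.
rewrite /= /cayley_adj (inj_eq (mulgI k)) !invgM -!mulgA.
by rewrite !(mulgA k^-1) !mulVg !mul1g.
Qed.

Lemma gdist_mull k g h : gdist ((k : Gp) * g : X) ((k : Gp) * h : X) = gdist g h.
Proof.
suff H k' g' h' : gdist ((k' : Gp) * g' : X) ((k' : Gp) * h' : X) <= gdist (g' : X) h'.
  by apply/eqP; rewrite eqn_leq H -{1}[g](mulKg k) -{1}[h](mulKg k) H.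
have [p [gp <- <-]] := gdist_path (g' : X) h'.
pose m (h : X) : X := (k' : Gp) * (h : Gp).
rewrite -/(m g') -/(m (last g' p)) -last_map -(size_map m p); apply: gdist_le.
by rewrite path_map; apply: sub_path gp => x y; rewrite -(adj_mull k').
Qed.

Lemma gdist_mulr (g h : Gp) : gdist (g : X) (g * h : Gp) = gdist (1 : X) h.
Proof. by rewrite -[in LHS](mulg1 g) -mulgA gdist_mull mul1g. Qed.

Lemma gdist1E g h : gdist g h = gdist (1 : X) ((g : Gp)^-1 * h : X).
Proof. by rewrite -(gdist_mull (g : Gp)^-1) mulVg. Qed.

Hypothesis unbounded : forall n, exists g, n <= gdist (1 : X) g.

Lemma geodesic_segment n : exists F : nat -> X,
  (forall i, i < n -> adj (F i) (F i.+1)) /\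
  (forall i j, i <= j <= n -> gdist (F i) (F j) = j - i).
Proof.
have [g ng] := unbounded n; have [p [xp pg sp]] := gdist_path (1 : X) g.
pose F i := nth (1 : X) ((1 : X) :: p) i.
have stepF i : i < size p -> adj (F i) (F i.+1).
  by move=> ip; have /(pathP (1 : X))/(_ i ip) := xp.
have upF i m : i + m <= size p -> gdist (F i) (F (i + m)) <= m.
  elim: m => [|m IH] im; first by rewrite addn0 gdistxx.
  apply: leq_trans (gdist_triangle (F (i + m)) _ _) _.
  have /stepF/gdist_adj : i + m < size p by lia.
  by rewrite addnS; have := IH ltac:(lia); lia.
have FN : gdist (F 0) (F (size p)) = size p.
  by rewrite sp /F /= -[X in nth _ _ X]sp nth_last /= pg.
exists F; split=> [i ?|i j /andP[ij jn]]; first by apply: stepF; lia.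
have := upF i (j - i) ltac:(lia); have := upF 0 i ltac:(lia).
have := upF j (size p - j) ltac:(lia); rewrite add0n !subnKC//; last by lia.
have := gdist_triangle (F i) (F 0) (F (size p)).
have := gdist_triangle (F j) (F i) (F (size p)).
by rewrite FN; lia.
Qed.

(** Follow the two halves of a geodesic with midpoint [a]. They cannot both come
    within half of [gdist a c] of [c]: the points where they do would be at
    distance more than [gdist a c] along the geodesic, but closer through [c]. *)
Lemma escape n a c : exists a',
  joined (fun v => gdist a c <= 2 * gdist v c) n a a' /\ gdist a a' = n.
Proof.
have [F0 [adjF0 distF0]] := geodesic_segment (n + n).
pose F i : X := (a : Gp) * (F0 n : Gp)^-1 * (F0 i : Gp).
have Fn : F n = a by rewrite /F -mulgA mulVg mulg1.
have adjF i : i < n + n -> adj (F i) (F i.+1).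
  by move=> /adjF0; rewrite /F adj_mull.
have distF i j : i <= j <= n + n -> gdist (F i) (F j) = j - i.
  by move=> /distF0; rewrite /F gdist_mull.
have [up|] := pselect (forall i, n <= i <= n + n -> gdist a c <= 2 * gdist (F i) c).
  exists (F (n + n)); split; last by rewrite -[in LHS]Fn distF; lia.
  rewrite -{2}Fn -{2}[n]addn0.
  apply: (@joined_fun _ (fun i => F (n + i))) => i ?.
    by rewrite addnS; apply: adjF; lia.
  by apply: up; lia.
move=> /existsNP[i /not_implyP[ni /negP]]; rewrite -ltnNge => ci.
have down j : j <= n -> gdist a c <= 2 * gdist (F j) c.
  move=> jn; rewrite leqNgt; apply/negP => cj.
  have := distF j i ltac:(lia); have := distF n i ltac:(lia).
  have := distF j n ltac:(lia); rewrite Fn.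
  have := gdist_triangle c (F j) (F i); rewrite (gdist_sym c).
  have := gdist_triangle (F i) a c; have := gdist_triangle (F j) a c.
  rewrite (gdist_sym a (F j)); lia.
exists (F 0); split; last by rewrite gdist_sym -[in LHS]Fn distF; lia.
apply: joined_sym; rewrite -{2}Fn; apply: joined_fun => j ?; last exact: down.
by apply: adjF; lia.
Qed.

End CayleyGraph.

(** * Detours in right-angled Artin groups *)

Section RaagCayley.
Local Open Scope group_scope.
Context {V : finType} {E : rel V}.
Hypotheses (symE : symmetric E) (irrE : irreflexive E).
Context {S : seq (raag E)} (genS : generates S).
Local Notation X := (cayley_graph genS).
Implicit Types (g h k : raag E) (u : seq (V * bool)).

Lemma elt_commute (T T' : pred V) (v1 v2 : seq (V * bool)) :
  (forall a b, T a -> T' b -> E a b) ->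
  all (T \o fst) v1 -> all (T' \o fst) v2 ->
  elt v1 * elt v2 = elt v2 * elt v1 :> raag E.
Proof.
move=> TE + v2T; elim: v1 => [_|[a b] v1 IH]; first by rewrite elt_nil mul1g mulg1.
rewrite elt_cons /= => /andP[Ta /IH v12]; rewrite -mulgA v12 !mulgA; congr (_ * _).
elim: v2 v2T {IH v12} => [_|[a' b'] v2 IH]; first by rewrite elt_nil mul1g mulg1.
rewrite [elt (_ :: v2)]elt_cons /= => /andP[Ta' /IH v12].
rewrite mulgA -(elt_cat [:: (a, b)]) (elt_eq (raag_eq_swap b b' (TE _ _ Ta Ta'))).
by rewrite (elt_cat [:: (a', b')] [:: (a, b)]) -mulgA v12 mulgA.
Qed.

Lemma elt_split (T : pred V) u :
  (forall a b, T a -> ~~ T b -> E a b) ->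
  elt u = elt [seq a <- u | T a.1] * elt [seq a <- u | predC T a.1] :> raag E.
Proof.
move=> TE; elim: u => [|a u IH] /=; first by rewrite elt_nil mulg1.
rewrite [LHS]elt_cons IH; case: ifP => Ta /=; first by rewrite [in RHS]elt_cons mulgA.
rewrite [elt (a :: seq.filter _ _)]elt_cons !mulgA; congr (_ * _).
apply: esym; apply: (elt_commute (T := T) (T' := predC T)) => //.
  exact: filter_all.
by rewrite /= Ta.
Qed.

Lemma bilipschitz : exists L, [/\ 0 < L,
  forall g, wlen g <= L * gdist (1 : X) g & forall g, gdist (1 : X) g <= L * wlen g].
Proof.
pose L1 := \max_(s <- S) wlen s.
pose L2 := \max_(a : V * bool) gdist (1%g : X) (elt [:: a] : raag E).
have SL s : s \in S -> wlen s <= L1 by move=> sS; apply: leq_bigmax_seq.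
have VL a : gdist (1%g : X) (elt [:: a] : raag E) <= L2.
  by apply: (leq_bigmax (F := fun a => gdist (1%g : X) (elt [:: a] : raag E))).
exists (L1 + L2).+1; split=> // g.
  have [p [gp <- <-]] := gdist_path (1 : X) g.
  suff H k : path (@adj X) k p -> wlen (k^-1 * last k p) <= L1 * size p.
    have := H _ gp; rewrite invg1 mul1g => /leq_trans; apply.
    by rewrite leq_mul2r; apply/orP; right; lia.
  elim: p k {gp} => [|h p IH] k /=; first by rewrite mulVg wlen1.
  move=> /andP[/andP[_ kh] /IH]; rewrite mulnS => hp.
  rewrite -(mulVKg h (last h p)) mulgA.
  apply: leq_trans (wlenM _ _) _; apply: leq_add hp.
  by case/orP: kh => /SL //; rewrite -wlenV invgM invgK.
have [u <- <-] := wlen_word g.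
suff /leq_trans : gdist (1 : X) (elt u : raag E) <= L2 * size u.
  by apply; rewrite leq_mul2r; apply/orP; right; lia.
elim: u {g} => [|a u IH] /=; first by rewrite gdistxx.
rewrite elt_cons; apply: leq_trans (gdist_triangle (elt [:: a] : X) _ _) _.
by rewrite gdist_mulr mulnS leq_add.
Qed.

Section WithConstant.
Variable L : nat.
Hypothesis wlen_le : forall g, wlen g <= L * gdist (1 : X) g.
Hypothesis gdist_le : forall g, gdist (1 : X) g <= L * wlen g.

Definition outside (r : nat) : pred X := fun v => r <= wlen (v : raag E).

(** A letter amounts to at most [L] steps in the Cayley graph, and these change the
    word length by at most [L * L]. *)
Lemma joined_word r g u :
  (forall i, r + L * L <= wlen (g * elt (take i u))) ->
  joined (outside r) (L * size u) (g : X) (g * elt u).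
Proof.
elim: u g => [|a u IH] g far.
  have := far 0; rewrite /= elt_nil mulg1 muln0 => g0.
  by apply: joined_refl; rewrite /outside; lia.
rewrite elt_cons mulgA /= mulnS.
apply: (@joined_trans _ _ (g * elt [:: a] : X)); last first.
  by apply: IH => i; have := far i.+1; rewrite /= elt_cons mulgA.
have ga : gdist (g : X) (g * elt [:: a]) <= L.
  rewrite gdist_mulr; apply: leq_trans (gdist_le _) _.
  by rewrite -{2}[L]muln1 leq_mul2l (wlen_elt [:: a]) orbT.
apply: (joined_leq ga); apply: joined_sub (joined_gdist _ _) => v.
rewrite gdist1E => /leq_trans-/(_ _ ga) gv.
have := far 0; rewrite /= elt_nil mulg1 => g0.
have : wlen (g^-1 * v) <= L * L by rewrite (leq_trans (wlen_le _))// leq_mul2l gv orbT.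
have := wlen_le_mulr g (g^-1 * v); rewrite mulVKg.
rewrite /outside; lia.
Qed.

(** Here [B n] bounds the cost of going around the ball of radius [r] about 1
    between two elements of length at most [n]. The elements are required to be
    so far outside the ball that crude estimates suffice. *)
Definition detours (B : nat -> nat) : Prop := forall r n g h,
  2 * (r + L * L) <= wlen g <= n -> 2 * (r + L * L) <= wlen h <= n ->
  joined (outside r) (B n) (g : X) h.

(** An element of a direct product that is far from 1 has a coordinate far from 1:
    keep this coordinate while the other one is moved far away, and then change
    the first one. *)
Lemma detours_to_corner (T : pred V) x y r n (u1 u2 : seq (V * bool)) :
  (forall a b, T a -> ~~ T b -> E a b) -> T x -> ~~ T y ->
  all (T \o fst) u1 -> all (predC T \o fst) u2 -> size u1 + size u2 <= n ->
  r + L * L <= n ->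
  r + L * L <= wlen (elt u1 : raag E) ->
  joined (outside r) (L * (3 * n)) (elt u1 * elt u2 : X)
    (elt (nseq (r + L * L) (x, true)) * elt (nseq (r + L * L) (y, true))).
Proof.
move=> TE Tx Ty u1T u2T u12 rn r1; set m := r + L * L in rn r1 *.
have commT (v1 v2 : seq (V * bool)) : all (T \o fst) v1 -> all (predC T \o fst) v2 ->
    elt v1 * elt v2 = elt v2 * elt v1 :> raag E by exact: elt_commute.
have xT i : all (T \o fst) (nseq i (x, true)) by rewrite all_nseq /= Tx orbT.
have yT i : all (predC T \o fst) (nseq i (y, true)) by rewrite all_nseq /= Ty orbT.
have invT (T' : pred V) v : all (T' \o fst) v -> all (T' \o fst) (word_inv v).
  by move=> vT; rewrite all_rev all_map; apply: sub_all vT; case.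
have takeT (T' : pred V) i v : all (T' \o fst) v -> all (T' \o fst) (take i v).
  by rewrite -{1}(cat_take_drop i v) all_cat => /andP[].
(* Projecting to one factor does not increase the length. *)
have ret (T' : pred V) (v1 v2 : seq (V * bool)) : all (T' \o fst) v1 ->
    all (predC T' \o fst) v2 -> wlen (elt v1 : raag E) <= wlen (elt v1 * elt v2 : raag E).
  move=> v1T v2T; apply: leq_trans (wlen_retract T' _); rewrite -elt_cat retract_elt.
  rewrite filter_cat (all_filterP v1T).
  suff -> : [seq a <- v2 | T' a.1] = [::] by rewrite cats0.
  by elim: (v2) v2T => //= a v IH /andP[/negbTE-> /IH].
pose w1 := word_inv u2 ++ nseq m (y, true).
pose w2 := word_inv u1 ++ nseq m (x, true).
have w1T : all (predC T \o fst) w1 by rewrite all_cat (invT (predC T))// yT.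
have w2T : all (T \o fst) w2 by rewrite all_cat invT// xT.
have sw v c : size (word_inv v ++ nseq m c) = size v + m.
  by rewrite size_cat size_rev size_map size_nseq.
have e1 : elt u1 * elt u2 * elt w1 = elt u1 * elt (nseq m (y, true)) :> raag E.
  by rewrite elt_cat elt_inv -!mulgA mulVKg.
have e2 : elt u1 * elt (nseq m (y, true)) * elt w2 =
    elt (nseq m (x, true)) * elt (nseq m (y, true)) :> raag E.
  rewrite (commT _ _ u1T (yT m)) elt_cat elt_inv -!mulgA mulVKg.
  by rewrite -(commT _ _ (xT m) (yT m)).
have j1 : joined (outside r) (L * size w1) (elt u1 * elt u2 : X) (elt u1 * elt u2 * elt w1).
  apply: joined_word => i; apply: leq_trans r1 _.
  rewrite -mulgA -(elt_cat u2); apply: (ret T) => //.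
  by rewrite all_cat u2T takeT.
have j2 : joined (outside r) (L * size w2) (elt u1 * elt (nseq m (y, true)) : X)
    (elt u1 * elt (nseq m (y, true)) * elt w2).
  apply: joined_word => i.
  rewrite (commT _ _ u1T (yT m)) -mulgA -(elt_cat u1).
  apply: leq_trans (ret (predC T) _ _ _ _) => //.
    have := expo_wlen (E := E) (pred1 y) (nseq m (y, true)).
    by rewrite expo_nseq /= eqxx; lia.
  apply: sub_all (_ : all (T \o fst) _); first by move=> a /= ->.
  by rewrite all_cat u1T takeT.
rewrite e1 in j1; rewrite e2 in j2; apply: joined_leq (joined_trans j1 j2).
by rewrite !sw -mulnDr leq_mul2l; apply/orP; right; lia.
Qed.

Lemma join_detours : is_join E -> detours (fun n => (6 * L * n)%N).
Proof.
move=> [A [/finset.set0Pn[x xA] /finset.set0Pn[y]]]; rewrite finset.inE => yA AE.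
have AEC a b : a \notin A -> b \in A -> E a b by move=> aA bA; rewrite symE AE.
move=> r n; set m := r + L * L.
have corner g : 2 * m <= wlen g <= n -> joined (outside r) (3 * L * n) (g : X)
    (elt (nseq m (x, true)) * elt (nseq m (y, true))).
  move=> /andP[mg gn]; have [u uE su] := wlen_word g.
  have mn : m <= n by lia.
  pose u1 := [seq a <- u | a.1 \in A]; pose u2 := [seq a <- u | a.1 \notin A].
  have gE : g = elt u1 * elt u2 by rewrite -uE (elt_split (T := mem A)).
  have su12 : size u1 + size u2 = size u by rewrite !size_filter count_predC.
  have u1A : all (mem A \o fst) u1 by exact: filter_all.
  have u2A : all (predC (mem A) \o fst) u2 by exact: filter_all.
  have := wlenM (elt u1 : raag E) (elt u2); rewrite -gE => g12.
  rewrite (_ : 3 * L * n = L * (3 * n))%N; last by lia.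
  case: (leqP m (wlen (elt u1 : raag E))) => u1m.
    by rewrite gE; apply: (detours_to_corner (T := mem A)) => //; lia.
  rewrite gE (elt_commute AE u1A u2A).
  rewrite (elt_commute (T := mem A) (T' := predC (mem A)) (v1 := nseq m (x, true))
    (v2 := nseq m (y, true)) AE).
  - apply: (detours_to_corner (T := predC (mem A))) => //=; rewrite ?negbK//.
    + by move=> a b aA /negPn; apply: AEC.
    + by apply: sub_all u1A => a /= ->.
    + lia.
    + lia.
  - by rewrite all_nseq /= xA orbT.
  - by rewrite all_nseq /= yA orbT.
move=> g h /corner gc /corner hc; apply: joined_leq (joined_trans gc (joined_sym hc)).
by lia.
Qed.

(** In the flat spanned by two adjacent generators one can turn from the direction
    [x] to the direction [y]: first multiply by the power of [y], then cancel the
    power of [x]. One of the two exponents is always [m] in absolute value. *)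
Lemma turn r n m x y b c g : E x y -> wlen g <= n -> n + r + L * L <= m ->
  joined (outside r) (L * (2 * m)) (g * elt (nseq m (x, b)) : X)
    (g * elt (nseq m (y, c))).
Proof.
move=> xy gn nm; pose w := nseq m (y, c) ++ nseq m (x, ~~ b).
have xyC d e i j : elt (nseq i (x, d)) * elt (nseq j (y, e)) =
    elt (nseq j (y, e)) * elt (nseq i (x, d)) :> raag E.
  apply: (elt_commute (T := pred1 x) (T' := pred1 y)).
  - by move=> ? ? /eqP-> /eqP->.
  - by rewrite all_nseq /= eqxx orbT.
  - by rewrite all_nseq /= eqxx orbT.
have yx : y != x by apply: contraTneq xy => ->; rewrite irrE.
have invX d i : elt (nseq i (x, ~~ d)) = (elt (nseq i (x, d)))^-1 :> raag E.
  by rewrite -elt_inv /word_inv map_nseq rev_nseq.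
have wE : g * elt (nseq m (y, c)) = g * elt (nseq m (x, b)) * elt w.
  by rewrite elt_cat -!mulgA; congr (_ * _); rewrite invX mulgA xyC mulgK.
have -> : (2 * m = size w)%N by rewrite size_cat !size_nseq mul2n addnn.
rewrite wE; apply: joined_word => i; rewrite -mulgA -elt_cat.
suff mw : m <= wlen (elt (nseq m (x, b) ++ take i w) : raag E).
  rewrite -(leq_add2r (wlen g)); apply: leq_trans (wlen_le_mull g _).
  by apply: leq_trans mw; lia.
rewrite take_cat size_nseq; case: ltnP => im.
  rewrite take_nseq ?(ltnW im)//.
  have := expo_wlen (E := E) (pred1 x) (nseq m (x, b) ++ nseq i (y, c)).
  by rewrite expo_cat !expo_nseq /= eqxx (negbTE yx); case: b {wE w}; lia.
have := expo_wlen (E := E) (pred1 y) (nseq m (x, b) ++ nseq m (y, c) ++ take (i - m) (nseq m (x, ~~ b))).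
rewrite !expo_cat !expo_nseq /= eqxx eq_sym (negbTE yx).
have -> : expo (pred1 y) (take (i - m) (nseq m (x, ~~ b))) = 0%R.
  case: (leqP (i - m) m) => imm; first by rewrite take_nseq// expo_nseq /= eq_sym (negbTE yx).
  by rewrite take_oversize ?size_nseq 1?ltnW// expo_nseq /= eq_sym (negbTE yx).
by case: c {wE w}; lia.
Qed.

Lemma wlen_mul_nseq g x b m : m <= wlen (g * elt (nseq m (x, b))) + wlen g.
Proof.
apply: leq_trans (wlen_le_mull g _).
have := expo_wlen (E := E) (pred1 x) (nseq m (x, b)).
by rewrite expo_nseq /= eqxx; case: b; lia.
Qed.

Lemma turns r n m x p b c g : path E x p -> 0 < size p ->
  wlen g <= n -> n + r + L * L <= m ->
  joined (outside r) (L * (2 * m) * size p) (g * elt (nseq m (x, b)) : X)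
    (g * elt (nseq m (last x p, c))).
Proof.
move=> + + gn nm; elim: p x b => // y p IH x b /= /andP[xy yp] _.
rewrite mulnS; case: p yp IH => [_ _|z p yp IH].
  by rewrite muln0 addn0; apply: (turn b c xy gn nm).
exact: joined_trans (turn b true xy gn nm) (IH y true yp isT).
Qed.

(** The elements [g * x ^ i] and [g * x ^ - d] are at distance [i + d], so only one
    of the two rays from [g] can come close to 1. *)
Lemma one_way_far r m x g : 2 * (r + L * L) <= wlen g ->
  exists b, joined (outside r) (L * m) (g : X) (g * elt (nseq m (x, b))).
Proof.
move=> rg; set k := r + L * L in rg *.
have szE (b : bool) : (L * m = L * size (nseq m (x, b)))%N by rewrite size_nseq.
have [up|] := pselect (forall i, k <= wlen (g * elt (nseq i (x, true)))).
  exists true; rewrite (szE true); apply: joined_word => i.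
  case: (leqP i m) => im; first by rewrite take_nseq.
  by rewrite take_oversize ?size_nseq// ltnW.
move=> /existsNP[i /negP]; rewrite -ltnNge => gi.
exists false; rewrite (szE false); apply: joined_word => j.
suff down d : k <= wlen (g * elt (nseq d (x, false))).
  case: (leqP j m) => jm; first by rewrite take_nseq.
  by rewrite take_oversize ?size_nseq// ltnW.
rewrite leqNgt; apply/negP => gd.
have id : i + d <= wlen (g * elt (nseq i (x, true))) + wlen (g * elt (nseq d (x, false))).
  rewrite -(wlenV (g * elt (nseq i (x, true)))); apply: leq_trans (wlenM _ _).
  rewrite invgM -mulgA mulKg -elt_inv /word_inv map_nseq rev_nseq -elt_cat -nseqD.
  have := expo_wlen (E := E) (pred1 x) (nseq (i + d) (x, false)).
  by rewrite expo_nseq /= eqxx; lia.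
have szn e (b : bool) : wlen (elt (nseq e (x, b)) : raag E) <= e.
  by rewrite (leq_trans (wlen_elt _))// size_nseq.
have := wlen_le_mulr g (elt (nseq i (x, true))).
have := wlen_le_mulr g (elt (nseq d (x, false))).
by have := szn i true; have := szn d false; lia.
Qed.

Section ConnectedGraph.
Hypotheses (connE : is_connected E) (V_gt1 : 1 < #|V|).

Lemma ex_neighbor x : exists y, E x y.
Proof.
have [y yx] : exists y, y != x.
  have /card_gt1P[a [b [_ _ ab]]] := V_gt1.
  by have [ax|] := eqVneq a x; [exists b; rewrite -ax eq_sym|exists a].
have /connectP[[|z p]] := connE.2 x y; first by move=> _ e; rewrite e eqxx in yx.
by move=> /= /andP[xz _] _; exists z.
Qed.

Lemma ex_walk x y : exists p, [/\ path E x p, last x p = y & 0 < size p <= #|V|].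
Proof.
have [<-|xy] := eqVneq x y.
  have [z xz] := ex_neighbor x; exists [:: z; x] => /=.
  by rewrite xz symE xz; split.
have /connectP[p0 xp0 yE] := connE.2 x y.
move: yE; case: (shortenP xp0) => p xp up _ yE.
exists p; split=> //; rewrite lt0n size_eq0; apply/andP; split.
  by apply: contraNneq xy => p0E; rewrite yE p0E.
by have := max_card (mem (x :: p)); rewrite (card_uniqP up) => /ltnW.
Qed.

Lemma turn_around r n m x y b c g : wlen g <= n -> n + r + L * L <= m ->
  joined (outside r) (L * (2 * m) * #|V|) (g * elt (nseq m (x, b)) : X)
    (g * elt (nseq m (y, c))).
Proof.
have [p [xp <- /andP[p0 pV]]] := ex_walk x y => gn nm.
apply: joined_leq (turns b c xp p0 gn nm).
by rewrite leq_mul2l pV orbT.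
Qed.

(** The letters of [u] are removed one at a time: the last one commutes with some
    generator [y] and passes through a large power of [y], so turn from [x] to
    [y], remove it, and turn back. *)
Lemma peel_letters r n m x u : size u <= n -> n + r + L * L <= m ->
  joined (outside r) (size u * (2 * (L * (2 * m) * #|V|) + L))
    (elt u * elt (nseq m (x, true)) : X) (elt (nseq m (x, true))).
Proof.
move=> + nm; elim/last_ind: u => [_|u [s d] IH].
  rewrite elt_nil mul1g; apply: joined_refl.
  by have := wlen_mul_nseq 1 x true m; rewrite wlen1 mul1g /outside; lia.
rewrite size_rcons => un; have [y sy] := ex_neighbor s.
have usn : wlen (elt (rcons u (s, d)) : raag E) <= n.
  by rewrite (leq_trans (wlen_elt _))// size_rcons.
have uS : wlen (elt u : raag E) <= n by rewrite (leq_trans (wlen_elt _))// ltnW.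
have t1 := turn_around x y true true usn nm.
have t2 := turn_around y x true true uS nm.
have sE : elt (rcons u (s, d)) * elt (nseq m (y, true)) =
    elt u * elt (nseq m (y, true)) * elt [:: (s, d)] :> raag E.
  rewrite elt_rcons -!mulgA; congr (_ * _).
  apply: (elt_commute (T := pred1 s) (T' := pred1 y)).
  - by move=> ? ? /eqP-> /eqP->.
  - by rewrite /= eqxx.
  - by rewrite all_nseq /= eqxx orbT.
have j : joined (outside r) (L * 1) (elt u * elt (nseq m (y, true)) : X)
    (elt u * elt (nseq m (y, true)) * elt [:: (s, d)]).
  apply: (@joined_word _ _ [:: (s, d)]) => -[|i] /=.
    by rewrite elt_nil mulg1; have := wlen_mul_nseq (elt u) y true m; lia.
  by rewrite -sE; have := wlen_mul_nseq (elt (rcons u (s, d))) y true m; lia.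
rewrite -sE in j.
apply: joined_leq (joined_trans t1 (joined_trans (joined_sym j) (joined_trans t2 (IH _)))).
  by rewrite mulSn; lia.
exact: ltnW.
Qed.

(** Each of the at most [n] letters of an element costs a bounded number of turns
    of length proportional to [n]. *)
Lemma connected_detours : detours (fun n => (L * (6 + 24 * #|V|) * n ^ 2)%N).
Proof.
move=> r n; have [x _] : exists x, x \in V by apply/card_gt0P; exact: ltnW.
set k := r + L * L; set m := n + k.
have toX g : 2 * k <= wlen g <= n ->
    joined (outside r) (L * (3 + 12 * #|V|) * n ^ 2) (g : X) (elt (nseq m (x, true))).
  move=> /andP[kg gn]; have nm : n + r + L * L <= m by rewrite /m /k; lia.
  have [b j1] := one_way_far m x kg.
  have j2 := turn_around x x b true gn nm.
  have [u uE su] := wlen_word g; have un : size u <= n by rewrite su.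
  have := peel_letters x un nm; rewrite uE => j3.
  apply: joined_leq (joined_trans j1 (joined_trans j2 j3)).
  have mn : m <= 2 * n by rewrite /m; lia.
  have n2 : n <= n ^ 2 by rewrite expnS expn1; case: (n) => // ?; rewrite leq_pmull.
  have a1 : L * m <= 2 * (L * n) by nia.
  have a2 : L * (2 * m) * #|V| <= 4 * (L * n * #|V|) by nia.
  have a3 : size u * (2 * (L * (2 * m) * #|V|) + L) <= n * (8 * (L * n * #|V|) + L).
    by apply: leq_mul => //; lia.
  have a4 : L * n <= L * n ^ 2 by rewrite leq_mul2l n2 orbT.
  have a5 : L * n * #|V| <= L * n ^ 2 * #|V| by rewrite leq_mul2r a4 orbT.
  rewrite expnS expn1 in a4 a5 *; nia.
move=> g h /toX gx /toX hx; apply: joined_leq (joined_trans gx (joined_sym hx)).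
by nia.
Qed.

End ConnectedGraph.

Hypothesis L_gt0 : (0 < L)%N.

(** After an escape of this length from a point at distance at most [K] of the
    centre, the hypotheses of [detours] hold for the radius [L * K]. *)
Definition escape_length (K : nat) : nat := K + 2 * L * (L * K + L * L).

(** Run away from [c] along a geodesic that stays outside the half ball, until
    the crude estimates of [detours] suffice. *)
Lemma joined_outside_half_ball B (a b c : X) K : (0 < #|V|)%N -> detours B ->
  gdist a c <= K -> gdist b c <= K ->
  joined (fun v => minn (gdist a c) (gdist b c) <= 2 * gdist v c)
    (2 * escape_length K + B (L * (escape_length K + K))%N) a b.
Proof.
move=> V0 detB ac bc; set N := escape_length K; set n := (L * (N + K))%N.
have unb m : exists g : X, m <= gdist (1 : X) g.
  have /card_gt0P[x _] := V0.
  exists (elt (nseq (L * m)%N (x, true)) : raag E).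
  have := wlen_mul_nseq 1 x true (L * m)%N; rewrite mul1g wlen1 addn0 => h.
  by have := leq_trans h (wlen_le _); rewrite leq_pmul2l.
have far (p : X) : gdist p c <= K -> exists p',
    joined (fun v => gdist p c <= 2 * gdist v c) N p p' /\
    2 * (L * K + L * L) <= wlen ((c : raag E)^-1 * (p' : raag E)) <= n.
  move=> pc; have [p' [jp pp']] := escape unb N p c; exists p'; split=> //.
  have e1 : N <= K + gdist c p'.
    by rewrite -pp' (leq_trans (gdist_triangle c _ _))// leq_add2r.
  have e2 : gdist c p' <= N + K.
    by rewrite (leq_trans (gdist_triangle p _ _))// gdist_sym addnC pp' leq_add2l.
  rewrite gdist1E in e1 e2; apply/andP; split; last first.
    by rewrite (leq_trans (wlen_le _))// leq_mul2l e2 orbT.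
  have e3 : 2 * L * (L * K + L * L) <= gdist (1 : X) ((c : raag E)^-1 * p').
    by move: e1; rewrite /N /escape_length leq_add2l.
  have := leq_trans e3 (gdist_le _); rewrite -mulnA mulnCA.
  by rewrite leq_pmul2l.
have [a' [ja fa]] := far a ac; have [b' [jb fb]] := far b bc.
have [q [cp qb qs Dq]] := detB _ _ _ _ fa fb.
have jab : joined (fun v => K <= gdist v c) (B n) a' b'.
  pose tr (v : X) : X := (c : raag E) * (v : raag E).
  exists (map tr q); split.
  - rewrite -[a'](mulVKg (c : raag E)) -/(tr _) path_map.
    by apply: sub_path cp => v w; rewrite -(adj_mull (c : raag E)).
  - by rewrite -[a'](mulVKg (c : raag E)) -/(tr _) last_map qb /tr mulVKg.
  - by rewrite size_map.
  - rewrite -[a'](mulVKg (c : raag E)) -/(tr _) -map_cons all_map.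
    apply: sub_all Dq => v; rewrite /outside /= gdist_sym gdist1E /tr mulKg => Lv.
    by have := leq_trans Lv (wlen_le _); rewrite leq_pmul2l.
pose D (v : X) := minn (gdist a c) (gdist b c) <= 2 * gdist v c.
have {}ja : joined D N a a'.
  by apply: joined_sub ja => v h; rewrite /D geq_min h.
have {}jb : joined D N b b'.
  by apply: joined_sub jb => v h; rewrite /D geq_min h orbT.
have {}jab : joined D (B n) a' b'.
  by apply: joined_sub jab => v h; rewrite /D geq_min; apply/orP; left; lia.
apply: joined_leq (joined_trans ja (joined_trans jab (joined_sym jb))).
by rewrite mul2n -addnn addnA addnAC.
Qed.

End WithConstant.
End RaagCayley.

(** * Growth of the divergence *)

Section Growth.
Local Open Scope ring_scope.
Context {R : realType} {V : finType} {E : rel V}.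
Hypotheses (symE : symmetric E) (irrE : irreflexive E).
Context {S : seq (raag E)} (genS : generates S).
Local Notation X := (cayley_graph genS).
Local Notation P := (realization R X).
Variable L : nat.
Hypothesis L_gt0 : (0 < L)%N.
Hypothesis wlen_le : forall g, (wlen g <= L * gdist (1%g : X) g)%N.
Hypothesis gdist_le : forall g, (gdist (1%g : X) g <= L * wlen g)%N.
Hypothesis V_gt0 : (0 < #|V|)%N.

(** If [c] is at distance at least [2 * r] from [a] and [b], a geodesic from [a]
    to [b] avoids the ball. Otherwise the vertices next to [a], [b] and [c] are
    at distance at most [3 * r + 1]. Rounding to vertices within 1/2 costs less
    than the constant 2 in the radius of the ball. *)
Lemma group_divergence_le B r K : detours genS L B -> 0 <= r -> 3 * r + 1 <= K%:R ->
  (group_divergence R genS r <=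
    (2 * escape_length L K + B (L * (escape_length L K + K))%N + K.+1)%:R%:E)%E.
Proof.
move=> detB r0 rK; apply: ge_ereal_sup => _ [[[a b] c] /= abr <-].
set k := dist_to_pair c a b; set D := [set p : P | 1 / 2 * k - 2 <= mdist c p]%classic.
have [ka kb] : k <= mdist c a /\ k <= mdist c b.
  by rewrite /k /dist_to_pair !ge_min !lexx orbT.
have k0 : 0 <= k by rewrite /k /dist_to_pair le_min !mdist_ge0.
have [va [la [la1 ava ja]]] := to_vertex a.
have [vb [lb [lb1 bvb jb]]] := to_vertex b.
have [vc cvc] := near_vertex c.
have nearD (x w : P) v : k <= mdist c x -> mdist x (vpoint v) <= 1 / 2 ->
    mdist w (vpoint v) <= 1 / 2 -> D w.
  move=> kx xv wv; rewrite /D /=.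
  have := metric_triangle c w x; have := metric_triangle w (vpoint v) x.
  rewrite (metric_sym (vpoint v) x); lra.
have {}ja : lip_joined D la a (vpoint va).
  by apply: lip_joined_sub ja => w; exact: nearD ka ava.
have {}jb : lip_joined D lb b (vpoint vb).
  by apply: lip_joined_sub jb => w; exact: nearD kb bvb.
suff [n nle [l ln jab]] : exists2 n,
    (n <= 2 * escape_length L K + B (L * (escape_length L K + K)) + K)%N &
    exists2 l, l <= n%:R & lip_joined D l (vpoint va) (vpoint vb).
  have := div_le_lip (rho := fun k => 1 / 2 * k - 2)
    (lip_joined_trans (lip_joined_trans ja jab) (lip_joined_sym jb)).
  move=> /le_trans; apply; rewrite lee_fin.
  move: nle; rewrite addnS -(ler_nat R) => nle.
  by rewrite mulrS; lra.
have nab : (gdist va vb)%:R <= r + 1.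
  rewrite -mdist_vpoint; have := metric_triangle (vpoint va) a (vpoint vb).
  have := metric_triangle a b (vpoint vb); rewrite (metric_sym (vpoint va) a); lra.
have [kr|kr] := leP (2 * r) k.
  exists (gdist va vb).
    by apply: leq_trans (leq_addl _ _); rewrite -(ler_nat R); lra.
  apply: lip_joined_path (joined_gdist va vb) => v; move=> q; move: (q : P) => {}q vab qv.
  rewrite /D /=.
  have := metric_triangle c q a; have := metric_triangle q (vpoint v) a.
  have := metric_triangle (vpoint v) (vpoint va) a.
  rewrite (metric_sym (vpoint va) a) (metric_sym (vpoint v) (vpoint va)) mdist_vpoint.
  have : (gdist va v)%:R <= (gdist va vb)%:R :> R by rewrite ler_nat.
  lra.
have kab : mdist c a <= k + r /\ mdist c b <= k + r.
  have := metric_triangle c a b; have := metric_triangle c b a.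
  rewrite (metric_sym b a) /k /dist_to_pair minEle.
  by move=> ? ?; case: (leP (mdist c a) (mdist c b)) => ?; split; lra.
have dv w v : mdist w (vpoint v) <= 1 / 2 ->
    mdist c w - 1 <= (gdist v vc)%:R <= mdist c w + 1.
  move=> wv; rewrite -(mdist_vpoint (R := R)).
  have := metric_triangle (vpoint v) w (vpoint vc).
  have := metric_triangle w c (vpoint vc).
  have := metric_triangle c (vpoint vc) w.
  have := metric_triangle (vpoint vc) (vpoint v) w.
  rewrite (metric_sym (vpoint vc) (vpoint v)) (metric_sym (vpoint v) w) (metric_sym w c).
  by move=> ? ? ? ?; apply/andP; split; lra.
have /andP[ac1 ac2] := dv _ _ ava; have /andP[bc1 bc2] := dv _ _ bvb.
have aK : (gdist va vc <= K)%N by rewrite -(ler_nat R); lra.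
have bK : (gdist vb vc <= K)%N by rewrite -(ler_nat R); lra.
eexists; last first.
  apply: lip_joined_path (joined_outside_half_ball wlen_le gdist_le L_gt0 V_gt0 detB aK bK).
  move=> v q; move: (q : P) => {}q vab qv; rewrite /D /=.
  have /andP[_] := dv _ _ qv.
  move: vab; rewrite geq_min => /orP[]; rewrite -(ler_nat R) natrM; lra.
by rewrite leq_addr.
Qed.

Lemma group_divergence_upper C d : (0 < d)%N ->
  detours genS L (fun n => C * n ^ d)%N ->
  exists2 A : R, 0 < A & forall r, 0 <= r ->
    (group_divergence R genS r <= (A * (3 * r + 3) ^+ d)%:E)%E.
Proof.
move=> d0 detB.
(* A common linear bound for the two lengths in [group_divergence_le]. *)
pose C' := (L.+1 * (2 + 2 * L * (L + L * L)))%N.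
have escC K : (L * (escape_length L K + K) <= C' * K.+1)%N.
  rewrite /C' -mulnA; apply: leq_mul => //; rewrite /escape_length !mulnS !mulnDl; nia.
have escC1 K : (escape_length L K <= C' * K.+1)%N.
  rewrite /C' -mulnA; apply: leq_trans (leq_pmull _ _); rewrite ?ltnS//.
  by rewrite /escape_length !mulnS !mulnDl; nia.
pose A := (2 * C' + C * C' ^ d + 1)%N.
exists A%:R; first by rewrite ltr0n /A addn1.
move=> r r0; have r1 : 0 <= 3 * r + 1 by lra.
have /andP[tr1 tr2] := truncn_itv r1; set K := (Num.truncn (3 * r + 1)).+1 in tr2.
apply: le_trans (group_divergence_le detB r0 (ltW tr2)) _; rewrite lee_fin.
have Kd : (K.+1 <= K.+1 ^ d)%N by case: (d) d0 => // d' _; rewrite expnS leq_pmulr// expn_gt0.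
apply: (@le_trans _ _ (A * K.+1 ^ d)%:R).
  rewrite ler_nat /A !mulnDl mul1n; apply: leq_add => //; apply: leq_add.
    rewrite -mulnA leq_mul2l /=; apply: leq_trans (escC1 K) _.
    by rewrite leq_mul2l Kd orbT.
  by rewrite -mulnA leq_mul2l -expnMn leq_exp2r// escC orbT.
rewrite natrM natrX ler_wpM2l// lerXn2r ?nnegrE//; first lra.
by rewrite /K in tr2 *; move: tr1; rewrite !mulrS; lra.
Qed.

Lemma path_word (c h : raag E) (p : seq X) (rho : nat) : path (@adj X) h p ->
  (forall v : X, v \in (h : X) :: p -> rho + L <= wlen (c^-1 * (v : raag E))%g)%N ->
  exists u, [/\ (size u <= L * size p)%N, (h * elt u)%g = last (h : X) p &
    forall i, (rho <= wlen (c^-1 * (h * elt (take i u)))%g)%N].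
Proof.
elim: p h => [|h' p IH] h /=.
  move=> _ far; exists [::]; rewrite elt_nil mulg1; split=> // i.
  by have := far h (mem_head _ _); lia.
move=> /andP[hh' hp] far.
have [|u [su uE ufar]] := IH h' hp.
  by move=> v vp; apply: far; rewrite inE vp orbT.
have [w wE sw] := wlen_word (h^-1 * (h' : raag E))%g.
have wL : (size w <= L)%N.
  rewrite sw (leq_trans (wlen_le _))// -(gdist1E (genS := genS)).
  by rewrite -{2}[L]muln1 leq_mul2l (gdist_adj (G := X) hh') orbT.
have hw : (h * elt w)%g = h' by rewrite wE mulVKg.
exists (w ++ u); split; first by rewrite size_cat mulnS leq_add.
  by rewrite elt_cat mulgA hw.
move=> i; rewrite take_cat; case: ltnP => iw; last by rewrite elt_cat (mulgA h) hw.
rewrite -(leq_add2r L) mulgA; apply: leq_trans (far h (mem_head _ _)) _.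
apply: leq_trans (wlen_le_mulr _ (elt (take i w))) _; rewrite leq_add2l.
by rewrite (leq_trans (wlen_elt _))// size_take_min geq_min wL orbT.
Qed.

(** The centre is in the middle of a segment of the line. With this [M], a curve
    that avoids the ball gives a word that stays at distance [n * l + l + n] from
    the centre, and by [detour_length] this word has length at least [n * n]. *)
Lemma curve_lower_bound (x : nat -> V) (l n M : nat) (Q : R) :
  (forall i, ~~ E (x i) (x i.+1)) ->
  (forall j z, exists2 i, (j <= i < j + l)%N & x i = z) ->
  M = (2 * L * L * (n * l + l + n + L) + 6 * L)%N ->
  L%:R * (2 * Q + 1) < n%:R ^+ 2 ->
  (Q%:E <= group_divergence R genS (L * (2 * M))%:R)%E.
Proof.
move=> nonadj cover ME Qn.
pose p0 : X := line x 0; pose p1 : X := line x (2 * M); pose pc : X := line x M.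
have wline i k : wlen ((line (E := E) x i)^-1 * line x (i + k))%g = k.
  by rewrite lineD mulKg wlen_line.
have d01 : mdist (vpoint p0 : P) (vpoint p1) <= (L * (2 * M))%:R.
  rewrite mdist_vpoint ler_nat gdist1E (leq_trans (gdist_le _))//.
  by rewrite leq_mul2l -[(2 * M)%N]add0n wline leqnn orbT.
have dc0 : (M <= L * gdist pc p0)%N.
  by rewrite gdist_sym gdist1E -[leqLHS](wline 0 M) add0n wlen_le.
have dc1 : (M <= L * gdist pc p1)%N.
  by rewrite gdist1E -[leqLHS](wline M M) addnn -mul2n wlen_le.
have k0 (p : X) : (M <= L * gdist pc p)%N ->
    (2 * L * (n * l + l + n + L) + 6 <= gdist pc p)%N.
  move=> Mp; rewrite -(leq_pmul2l L_gt0); apply: leq_trans Mp.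
  by rewrite ME !mulnDr !mulnA; lia.
apply: le_trans (ereal_sup_ubound _); last by exists (vpoint p0, vpoint p1, vpoint pc).
apply/ereal_infP => _ [g [gC far] <-] /=.
rewrite leNgt; apply/negP => /ltW gQ.
have [r [xr ry sr near]] := curve_to_path gC gQ.
set rho := (n * l + l + n)%N in ME k0.
have [|u [su uE ufar]] := @path_word (line x M) 1%g r rho xr.
  move=> v /near[t t01 vt]; have := far t t01.
  have tri := metric_triangle (vpoint pc) (g t) (vpoint v).
  have tri' := metric_triangle (vpoint pc) (vpoint v) (g t).
  rewrite mdist_vpoint in tri'.
  have : (2 * L * (rho + L) + 6)%:R <= dist_to_pair (vpoint pc) (vpoint p0) (vpoint p1) :> R.
    by rewrite /dist_to_pair le_min !mdist_vpoint !ler_nat !k0.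
  rewrite !natrD !natrM /= => kmin gt.
  rewrite -(leq_pmul2l L_gt0).
  have : (L * (rho + L))%:R <= (gdist pc v)%:R :> R by rewrite natrM natrD; lra.
  rewrite ler_nat => /leq_trans; apply.
  by rewrite gdist1E gdist_le.
rewrite ry mul1g in uE.
have nlM : (M + n * l < 2 * M)%N.
  rewrite mul2n -addnn ltn_add2l ME; apply: (@leq_ltn_trans (2 * L * L * (rho + L))).
    by apply: leq_trans (leq_pmull _ _); rewrite ?muln_gt0 ?L_gt0// /rho; lia.
  by rewrite -[ltnLHS]addn0 ltn_add2l muln_gt0.
have ufar' i : (rho <= wlen ((line (E := E) x M)^-1 * elt (take i u))%g)%N.
  by have := ufar i; rewrite mul1g.
have := detour_length symE irrE nonadj cover uE nlM ufar'.
have -> : (rho - n * l - l = n)%N by rewrite /rho; lia.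
move=> /leq_trans-/(_ _ su); rewrite -(ler_nat R) !natrM.
have : L%:R * (size r)%:R <= L%:R * (2 * Q + 1) by rewrite ler_wpM2l.
rewrite expr2 in Qn; lra.
Qed.

Lemma group_divergence_mono r r' : r <= r' ->
  (group_divergence R genS r <= group_divergence R genS r')%E.
Proof.
move=> rr'; apply: ge_ereal_sup => _ [p /= pr <-].
by apply: ereal_sup_ubound; exists p => //=; exact: le_trans rr'.
Qed.

Lemma group_divergence_lower : ~ is_join E ->
  exists a b c r0 : R, 0 < a /\ forall r, r0 <= r ->
    ((a * r ^+ 2 + b * r + c)%:E <= group_divergence R genS r)%E.
Proof.
move=> nj; have [x [l [nonadj cover]]] := nonjoin_walk irrE nj V_gt0.
pose D := (2 * L * (2 * L * L * (l + l + 1 + L) + 6 * L))%N.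
have D0 : 0 < D%:R :> R by rewrite ltr0n /D; nia.
have L0 : 0 < L%:R :> R by rewrite ltr0n.
have MD n : (L * (2 * (2 * L * L * (n * l + l + n + L) + 6 * L)) <= D * n.+1)%N.
  rewrite /D; have : (n * l + l + n + L <= (l + l + 1 + L) * n.+1)%N by nia.
  move: (n * l + l + n + L)%N (l + l + 1 + L)%N => s t st.
  have : (2 * L * L * s <= 2 * L * L * t * n.+1)%N by rewrite -(mulnA (2 * L * L)%N t) leq_mul2l st orbT.
  move: (2 * L * L * s)%N (2 * L * L * t)%N => s' t' st'.
  rewrite -(mulnA (2 * L)%N) (mulnCA L 2%N) (mulnA 2%N L) leq_mul2l; apply/orP; right.
  by rewrite mulnDl; apply: leq_add => //; rewrite leq_pmulr.
(* A lower bound for the integer [n] to be used at [r], which is the integral part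
   of [r / D - 1]. *)
pose y r : R := r / D%:R - 2.
have low r : 2 * D%:R <= r ->
    (((y r ^+ 2 / L%:R - 3) / 2)%:E <= group_divergence R genS r)%E.
  move=> r2; have rD : 2 <= r / D%:R by rewrite ler_pdivlMr.
  have rD0 : 0 <= r / D%:R - 1 by lra.
  have /andP[n1 n2] := truncn_itv rD0; set n := Num.truncn _ in n1 n2.
  have yn : y r ^+ 2 <= n%:R ^+ 2.
    by rewrite lerXn2r ?nnegrE//; rewrite /y ?mulrS in n2 *; lra.
  apply: le_trans (curve_lower_bound nonadj cover (erefl _) _) (group_divergence_mono _).
    apply: lt_le_trans yn; set z := y r ^+ 2 / L%:R.
    have -> : y r ^+ 2 = L%:R * z by rewrite mulrC divfK// gt_eqF.
    rewrite ltr_pM2l//; lra.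
  apply: (@le_trans _ _ (D * n.+1)%:R); first by rewrite ler_nat MD.
  by rewrite natrM mulrC -ler_pdivlMr// mulrS; lra.
exists (1 / (2 * L%:R * D%:R ^+ 2)), (- (2 / (L%:R * D%:R))), (2 / L%:R - 3 / 2), (2 * D%:R).
split; first by rewrite divr_gt0// !mulr_gt0// exprn_gt0.
move=> r /low; congr (_ <= _)%E; congr EFin; rewrite /y.
by field; rewrite !lt0r_neq0.
Qed.

Lemma quadratic_not_linear (f : R -> \bar R) (a b c r0 : R) : 0 < a ->
  (forall r, r0 <= r -> ((a * r ^+ 2 + b * r + c)%:E <= f r)%E) ->
  ~ linear_growth f.
Proof.
move=> a0 fge [a1 [b1 fle]].
pose m := `|b| + `|c| + `|a1| + `|b1| + 1.
pose r := m / a + 1 + `|r0|.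
have m0 : 0 < m by rewrite ltr_wpDl// !addr_ge0.
have ma : 0 < m / a by rewrite divr_gt0.
have r0r : r0 <= r by have := ler_norm r0; rewrite /r; lra.
have r1 : 1 <= r by have := normr_ge0 r0; rewrite /r; lra.
have mr : m <= a * r.
  rewrite mulrC -ler_pdivrMr//; have := normr_ge0 r0; rewrite /r; lra.
have := le_trans (fge r r0r) (fle r (le_trans ler01 r1)); rewrite lee_fin.
have mr2 : m * r <= a * r ^+ 2 by rewrite expr2 mulrA ler_wpM2r//; lra.
have h (z : R) : - (`|z| * r) <= z * r /\ z * r <= `|z| * r /\ `|z| <= `|z| * r.
  have r0' : 0 <= r by lra.
  split; first by rewrite -mulNr ler_wpM2r// lerNnormlW.
  by split; [rewrite ler_wpM2r// ler_norm|rewrite ler_peMr].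
have [b_ _] := h b; have [_ [a1_ _]] := h a1; have [_ [_ c_]] := h c.
have [_ [_ b1_]] := h b1.
have := ler_norm b1; have : - `|c| <= c by rewrite lerNnormlW.
move: mr2; rewrite /m !mulrDl mul1r; lra.
Qed.

End Growth.

Theorem corollary5p4 (R : realType) (V : finType) (E : rel V)
    (symE : symmetric E) (irrE : irreflexive E) (connE : is_connected E)
    (S : seq (raag E)) (genS : generates S) :
  (linear_growth (group_divergence R genS) <-> is_join E) /\
  (~ is_join E -> (1 < #|V|)%N -> quadratic_growth (group_divergence R genS)).
Proof.
have [L [L0 wle gle]] := bilipschitz genS; have [V0 _] := connE.
split.
  split=> [lin|joinE].
    apply: contrapT => /(group_divergence_lower (R := R) symE irrE L0 wle gle V0).
    by move=> [a [b [c [r0 [a0 /(quadratic_not_linear a0)]]]]].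
  have det := join_detours symE wle gle joinE.
  have [A A0 Ale] :=
    group_divergence_upper (R := R) (d := 1) L0 wle gle V0 isT det.
  exists (3 * A)%R, (3 * A)%R => r /Ale; rewrite expr1.
  by congr (_ <= _)%E; congr EFin; ring.
move=> nj V1; have det := connected_detours symE irrE wle gle connE V1.
have [A A0 Ale] := group_divergence_upper (R := R) L0 wle gle V0 (isT : (0 < 2)%N) det.
have [a [b [c [r0 [a0 low]]]]] := group_divergence_lower (R := R) symE irrE L0 wle gle V0 nj.
exists a, b, c, (9 * A)%R, (18 * A)%R, (9 * A)%R; split=> //; first by lra.
near=> r; split; first by apply: low; near: r; apply: nbhs_pinfty_ge; exact: num_real.
have : (0 <= r)%R by near: r; apply: nbhs_pinfty_ge; exact: num_real.
move=> /Ale; congr (_ <= _)%E; congr EFin; ring.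
Unshelve. all: by end_near.
Qed.
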